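(* Let $\mathbf X$ be a finite dimensional Hilbert space, let $\Omega\subset\mathbf X$, $\bar x\in\Omega$, and assume that $\Omega$ is locally closed around $\bar x$. Consider the properties: (a) $\Omega$ is strictly smooth at $\bar x$; (b) $\lim_{x\to\bar x,\ x\in\Omega}T_\Omega(x)=T_\Omega(\bar x)$. Then the implication (a)$\implies$(b) always holds. If, in addition, $\Omega$ is a Lipschitzian manifold around $\bar x$, then the opposite implication (b)$\implies$(a) holds as well, and in this case (a) and (b) are also equivalent to each of the following properties: (c) $T_\Omega(x)$ converges to $T_\Omega(\bar x)$ as $x\to\bar x$ in the set of points $x\in\Omega$ for which $\check T_\Omega(x)=T_\Omega(x)$; (d) $T_\Omega(x)$ converges to $T_\Omega(\bar x)$ as $x\to\bar x$ in the set of points $x\in\Omega$ at which $\Omega$ is smooth; (e) $T_\Omega(x)$ converges (to some set) as $x\to\bar x$ in the set of points $x\in\Omega$ at which $\Omega$ is smooth.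
   Context: Set limits are in the Painlevé–Kuratowski sense (inner limit equals outer limit). For $\Omega\subset\mathbf X$ and $x\in\Omega$: the tangent cone is $T_\Omega(x)=\limsup_{t\searrow0}\frac{\Omega-x}{t}$; the derivable (adjacent) cone is $\check T_\Omega(x)=\liminf_{t\searrow0}\frac{\Omega-x}{t}$; the regular (Clarke) tangent cone is $\widehat T_\Omega(x)=\liminf_{x'\to x,\,x'\in\Omega,\,t\searrow0}\frac{\Omega-x'}{t}$; the paratingent cone is $\widetilde T_\Omega(x)=\limsup_{x'\to x,\,x'\in\Omega,\,t\searrow0}\frac{\Omega-x'}{t}$. $\Omega$ is smooth at $x\in\Omega$ if $\check T_\Omega(x)=T_\Omega(x)$ and $T_\Omega(x)$ is a linear subspace of $\mathbf X$. $\Omega$ is strictly smooth at $x$ if $\widehat T_\Omega(x)=\widetilde T_\Omega(x)$. $\Omega$ is a Lipschitzian manifold around $\bar x$ if there are an open neighborhood $O$ of $\bar x$, a splitting $\mathbf X=\mathbf Y\times\mathbf Z$ with $\mathbf Y,\mathbf Z$ finite dimensional Hilbert spaces, and a $\mathcal C^1$-diffeomorphism $\Phi$ from $O$ onto an open subset $U=U'\times U''$ of $\mathbf Y\times\mathbf Z$ such that $\Phi(\Omega\cap O)=(\mathrm{gph}\,f)\cap U$, where $f:U'\to U''$ is a Lipschitz continuous function. *)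

(* Defs.v *)
From HB Require Import structures.
From mathcomp Require Import all_boot all_order all_algebra sesquilinear.
From mathcomp Require Import all_classical all_reals all_analysis.

Set Implicit Arguments.
Unset Strict Implicit.
Unset Printing Implicit Defensive.

Import Order.TTheory GRing.Theory Num.Theory.
Import numFieldNormedType.Exports.
Local Open Scope classical_set_scope.
Local Open Scope ring_scope.

(* Completeness is not required separately: it is automatic in finite
   dimension, which is imposed by the [Vector] structure. *)
HB.mixin Record NormedModule_isHilbert (R : realType) V
    of NormedModule R V & Vector R V := {
  inner : {dot V for (idfun : R -> R)} ;
  inner_normE : forall u : V, `|u| ^+ 2 = inner u u
}.

#[short(type="finHilbertType")]
HB.structure Definition FinHilbert (R : realType) :=
  {V of NormedModule R V & Vector R V & NormedModule_isHilbert R V}.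

Section SetLimits.
Context {T : Type} {X : topologicalType}.
Implicit Types (F : set_system T) (S : T -> set X).

(* Painleve-Kuratowski limits in neighborhood form: v is an outer limit point
   when every neighborhood of v meets S t frequently along F, and an inner
   limit point when it does so eventually. *)
Definition outer_limit F S : set X :=
  \bigcap_(A in F) closure (\bigcup_(t in A) S t).

Definition inner_limit F S : set X :=
  [set v | forall V, nbhs v V -> \forall t \near F, S t `&` V !=set0].

Definition set_converges F S (L : set X) : Prop :=
  inner_limit F S = L /\ outer_limit F S = L.

End SetLimits.

Section Cones.
Context {R : realType} {X : finHilbertType R}.
Implicit Types (Omega : set X) (x : X).

Definition diff_quotient Omega x (t : R) : set X :=
  [set t^-1 *: (y - x) | y in Omega].

Definition tangent_cone Omega x : set X :=
  outer_limit 0^'+ (diff_quotient Omega x).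

Definition derivable_cone Omega x : set X :=
  inner_limit 0^'+ (diff_quotient Omega x).

(* As usual for limits relative to Omega, x' = x is allowed. *)
Definition base_point_filter Omega x : set_system (X * R) :=
  filter_prod (within Omega (nbhs x)) 0^'+.

Definition regular_tangent_cone Omega x : set X :=
  inner_limit (base_point_filter Omega x)
    (fun p => diff_quotient Omega p.1 p.2).

Definition paratingent_cone Omega x : set X :=
  outer_limit (base_point_filter Omega x)
    (fun p => diff_quotient Omega p.1 p.2).

Definition derivable_at Omega x : Prop :=
  derivable_cone Omega x = tangent_cone Omega x.

Definition smooth_at Omega x : Prop :=
  derivable_at Omega x /\
  exists V : {vspace X}, tangent_cone Omega x = [set` V].

Definition strictly_smooth_at Omega x : Prop :=
  regular_tangent_cone Omega x = paratingent_cone Omega x.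

Definition locally_closed_at Omega x : Prop :=
  exists V : set X, [/\ nbhs x V, closed V & closed (Omega `&` V)].

End Cones.

Section C1.
Context {R : realType} {V W : normedModType R}.

(* The derivative is continuous for the operator norm. *)
Definition C1_on (O : set V) (f : V -> W) : Prop :=
  forall x, O x -> differentiable f x /\
    forall e : R, 0 < e -> \forall x' \near x,
      forall v : V, `|'d f x' v - 'd f x v| <= e * `|v|.

End C1.

Definition C1_diffeo {R : realType} {V W : normedModType R}
    (O : set V) (U : set W) (f : V -> W) : Prop :=
  [/\ set_bij O U f, C1_on O f &
      exists g : W -> V, {in O, cancel f g} /\ C1_on U g].

(* X is identified with the Hilbert space product of Y and Z; the ambient norm
   of the type Y * Z is the max norm, so the inner product is spelled out. *)
Definition splitting {R : realType} (X Y Z : finHilbertType R)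
    (J : {linear X -> (Y * Z)%type}) : Prop :=
  bijective J /\
  forall u v : X,
    inner u v = inner (J u).1 (J v).1 + inner (J u).2 (J v).2.

(* Functions U' -> U'' are represented by total functions mapping U' into U''
   and only their graph over U' is considered. *)
Definition graph_on {Y Z : Type} (U' : set Y) (f : Y -> Z) : set (Y * Z) :=
  [set p | U' p.1 /\ p.2 = f p.1].

Definition lipschitzian_manifold {R : realType} {X : finHilbertType R}
    (Omega : set X) (xbar : X) : Prop :=
  exists O : set X, [/\ open O, O xbar &
  exists (Y Z : finHilbertType R) (J : {linear X -> (Y * Z)%type}),
    splitting J /\
  exists (U' : set Y) (U'' : set Z) (Phi : X -> Y * Z) (f : Y -> Z),
    [/\ open (U' `*` U''), C1_diffeo O (U' `*` U'') Phi,
        f @` U' `<=` U'', [lipschitz f y | y in U'] &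
        Phi @` (Omega `&` O) = graph_on U' f `&` (U' `*` U'')]].

(* Main.v *)
(** (a) => (b): every direction of the regular cone at xbar is a limit of
    tangent directions at nearby points, by compactness, and every limit of
    tangent directions lies in the paratingent cone.

    For a Lipschitzian manifold, write Omega near xbar as the image of
    F y = g (y, f y) with g of class C^1 and f Lipschitz.  Where f is
    differentiable, Omega is smooth and its tangent cone is the range of the
    derivative of F; by Rademacher's theorem such points are dense.  If the
    tangent spaces at these points converge, then, being graphs (up to a change
    of coordinates) of uniformly bounded linear maps, they force f'(y) to
    converge to a linear map A as y tends to ybar.  A Lipschitz map whose
    derivative is small almost everywhere has a small Lipschitz constant;
    applied to f - A, this makes f, hence F, strictly differentiable, and then
    the paratingent and the regular cone are both the range of F'(ybar).

    Rademacher's theorem and this mean value inequality are proved together, by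
    induction on the dimension, for V x R: Fubini's theorem provides
    differentiability in V and in R separately at almost every point; they
    combine to joint differentiability at points around which the set where
    the increments in V are uniformly controlled is dense enough along R. *)

Require Import Defs.
From HB Require Import structures.
From mathcomp Require Import all_boot all_order all_algebra.
From mathcomp Require Import all_classical all_reals all_analysis.
From mathcomp Require Import measurable_realfun ring lra.

Set Implicit Arguments.
Unset Strict Implicit.
Unset Printing Implicit Defensive.

Import Order.TTheory GRing.Theory Num.Theory.
Import numFieldNormedType.Exports.
Local Open Scope classical_set_scope.
Local Open Scope ring_scope.

(** * Lipschitz functions of one real variable *)

Section OneDim.
Context {R : realType}.
Local Notation mu := (@lebesgue_measure R).
Implicit Types (h : R -> R) (L : R).

(** Fubini's theorem has to be applied to the sets where differentiability fails, so these sets must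
    be measurable. They are therefore covered by countable combinations of closed sets: radius and
    tolerance are fixed, and candidate derivatives come from a countable family. A true derivative
    is recovered only at the end, from approximations at every tolerance. The mean value inequality
    is likewise obtained slice by slice, outside a null set of slices, and reaches the other slices
    by Lipschitz continuity; its constant grows by 1 with each dimension. Both results concern
    functions that are Lipschitz on a whole model space, built from a zero space by repeated
    products with R, whereas [f] lives on an open subset of an abstract Hilbert space. Hence the
    detour through coordinates, bounded linear maps in both directions and a Lipschitz extension. *)

Definition lipschitz_with (V W : normedModType R) (L : R) (g : V -> W) :=
  forall x y, `|g x - g y| <= L * `|x - y|.

Lemma stieltjes_itv (k : cumulative R R) (a b : R) : a <= b ->
  lebesgue_stieltjes_measure k `]a, b]%classic = (k b - k a)%:E.
Proof.
move=> ab; rewrite /lebesgue_stieltjes_measure /measure_extension/=.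
rewrite measurable_mu_extE/=; last exact: is_ocitv.
by rewrite wlength_itv_bnd.
Qed.

(** Both measures are infima over covers by half-open intervals; comparing lengths interval by
    interval bounds [C^-1] times the Stieltjes measure by [mu]. *)
Lemma stieltjes_dominated (k : cumulative R R) (C : R) : 0 < C ->
  (forall s t, s <= t -> k t - k s <= C * (t - s)) ->
  lebesgue_stieltjes_measure k `<< mu.
Proof.
move=> C0 kC; apply/null_content_dominatesP => A mA A0.
apply/eqP; rewrite eq_le measure_ge0 andbT.
suff : ((C^-1)%:E * lebesgue_stieltjes_measure k A <= mu A)%E.
  by rewrite A0 pmule_rle0// lte_fin invr_gt0.
rewrite /lebesgue_measure /lebesgue_stieltjes_measure /measure_extension/=.
apply: le_ereal_inf_tmp => _ [F FA <-].
apply: (@le_trans _ _ ((C^-1)%:E * \sum_(i <oo) wlength k (F i))%E).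
  rewrite lee_pmul2l ?lte_fin ?invr_gt0//.
  by apply: ereal_inf_lbound; exists F.
rewrite -nneseriesZl; last by move=> i _; exact: wlength_ge0.
apply: lee_nneseries => [i _ _|n _].
  by rewrite mule_ge0 ?wlength_ge0// lee_fin invr_ge0 ltW.
have [/(_ n) + _] := FA.
case=> [[a b]] _ <-; have [ab|/ltW ba] := leP a b.
  rewrite !wlength_itv_bnd// -EFinM lee_fin ler_pdivrMl//.
  exact: kC.
by rewrite /= set_itv_ge ?bnd_simp -?leNgt// !wlength0 mule0.
Qed.

Lemma lipschitz_with_ge0 (V W : normedModType R) (L : R) (g : V -> W) (x : V) :
  lipschitz_with L g -> x != 0 -> 0 <= L.
Proof.
move=> gL x0; have := le_trans (normr_ge0 _) (gL x 0).
by rewrite subr0 pmulr_lge0// normr_gt0.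
Qed.

Lemma lipschitz_with_continuous (V W : normedModType R) (L : R) (g : V -> W) :
  lipschitz_with L g -> continuous g.
Proof.
move=> gL x; apply/cvgrPdist_lt => e e0.
have L0 : 0 < `|L| + 1 by rewrite ltr_wpDl.
near=> y; apply: le_lt_trans (gL _ _) _.
apply: (@le_lt_trans _ _ ((`|L| + 1) * `|x - y|)).
  by rewrite ler_wpM2r// (le_trans (ler_norm L))// lerDl.
rewrite -ltr_pdivlMl//; near: y; apply: cvgr_dist_lt => //.
by rewrite mulr_gt0// invr_gt0.
Unshelve. all: by end_near. Qed.

Lemma lipschitz_integral h L (a b : R) : lipschitz_with L h -> a < b ->
  exists rho : R -> R, mu.-integrable [set: R] (EFin \o rho) /\
    forall x, a <= x <= b -> h x - h a = (\int[mu]_(t in `]a, x]) rho t)%R.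
Proof.
move=> hL ab.
have L0 : 0 <= L by apply: (@lipschitz_with_ge0 R R L h 1 hL); rewrite oner_eq0.
(* k is increasing and its Stieltjes measure is dominated by the Lebesgue
   measure; rho is the Radon-Nikodym density, corrected by the slope L + 1. *)
pose k t := h t + (L + 1) * t.
have k_nd : {homo k : x y / x <= y}.
  move=> x y xy; rewrite /k; have := hL y x; rewrite ler_norml => /andP[+ _].
  rewrite ger0_norm ?subr_ge0//; lra.
have k_rc : right_continuous k.
  apply/right_continuousW => x; apply: cvgD; first exact: (lipschitz_with_continuous hL).
  by apply: cvgM; [exact: cvg_cst|exact: cvg_id].
pose kC := isCumulative.Build R _ R k k_nd k_rc.
pose kc : cumulative R R := HB.pack k kC.
have mD : measurable (`]a, b]%classic : set (measurableTypeR R)).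
  exact: measurable_itv.
have fD : (lebesgue_stieltjes_measure kc `]a, b]%classic < +oo)%E.
  by rewrite stieltjes_itv ?ltW// ltry.
(* Restricting to []a, b]] makes the measure finite before Radon-Nikodym is applied. *)
pose nu : {finite_measure set _ -> \bar R} := mfrestr mD fD.
have numu : nu `<< mu.
  apply/null_content_dominatesP => A mA A0.
  have /null_content_dominatesP kmu : lebesgue_stieltjes_measure kc `<< mu.
    (* A slope of [k] is at most [L + (L + 1)]. *)
    apply: (@stieltjes_dominated _ (2 * L + 1)); first lra.
    move=> s t st; rewrite /= /k; have := hL t s; rewrite ler_norml => /andP[_].
    rewrite ger0_norm ?subr_ge0//; lra.
  rewrite /nu /= /mfrestr /mrestr; apply: kmu; first exact: measurableI.
  apply/eqP; rewrite eq_le measure_ge0 andbT -A0.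
  by apply: le_measure; rewrite ?inE//; exact: measurableI.
have [f [f0 ff intf nuf]] := radon_nikodym_sigma_finite numu.
have int1 : mu.-integrable `]a, b]%classic (EFin \o (cst (L + 1))).
  apply/integrableP; split; first exact/measurable_EFinP/measurable_cst.
  rewrite (eq_integral (cst (`|L + 1|%:E)))// integral_cst//=.
  rewrite lebesgue_measure_itv/= lte_fin ab -EFinB.
  by rewrite -EFinM ltry.
pose rho := ((fine \o f) \_ `]a, b]%classic) \- (cst (L + 1)) \_ `]a, b]%classic.
have fE : EFin \o (fine \o f) = f.
  by apply/funext => x /=; rewrite fineK.
have intf' : mu.-integrable setT (EFin \o ((fine \o f) \_ `]a, b]%classic)).
  rewrite -restrict_EFin; apply: (iffLR (integrable_mkcond _ mD)); rewrite fE.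
  exact: (integrableS measurableT mD _ intf).
have int1' : mu.-integrable setT (EFin \o ((cst (L + 1)) \_ `]a, b]%classic)).
  by rewrite -restrict_EFin; apply: (iffLR (integrable_mkcond _ mD)).
exists rho; split.
  have := integrableB measurableT intf' int1'.
  by apply: eq_integrable => // x _.
move=> x /andP[ax xb].
have sub : `]a, x]%classic `<=` `]a, b]%classic.
  by apply: subset_itvl; rewrite bnd_simp.
rewrite RintegralB//=;
  [|exact: (integrableS measurableT)|exact: (integrableS measurableT)].
rewrite -!Rintegral_mkcondr (_ : _ `&` _ = `]a, x]%classic); last exact/setIidPl.
rewrite Rintegral_cst//= lebesgue_measure_itv/= lte_fin.
have -> : (\int[mu]_(t in `]a, x]) fine (f t))%R = k x - k a.
  rewrite /Rintegral; under eq_integral do rewrite fineK//.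
  rewrite -nuf//= /mfrestr /mrestr (_ : _ `&` _ = `]a, x]%classic); last exact/setIidPl.
  by rewrite stieltjes_itv.
rewrite /k.
have [ax'|] := ltP a x; first by rewrite -EFinD/=; lra.
move=> xa; have -> : x = a by apply/eqP; rewrite eq_le ax xa.
by rewrite /=; lra.
Qed.


(** First-order approximation at one fixed tolerance; [l] is an arbitrary function, so it may depend
    on [e] and range over a countable family. *)
Definition approx_at (V W : normedModType R) (g : V -> W) (x : V) (l : V -> W)
    (e : R) :=
  \forall u \near (0 : V), `|g (x + u) - g x - l u| <= e * `|u|.

(** The slack [eta] stands in for a limsup: this bounds the upper local slope, the limsup of
    [|g (x + u) - g x| / |u|] as [u] tends to 0. *)
Definition slope_le (V W : normedModType R) (g : V -> W) (e : R) (x : V) :=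
  forall eta : R, 0 < eta ->
    \forall u \near (0 : V), `|g (x + u) - g x| <= (e + eta) * `|u|.

Lemma derive1_approx h (t r e : R) : is_derive t 1 h r -> 0 < e ->
  approx_at h t ( *%R r) e.
Proof.
move=> [+ <-] e0; rewrite /derivable => /cvgrPdist_le/(_ e e0).
rewrite near_withinE; apply: filterS => u Hu.
have [->|u0] := eqVneq u 0; first by rewrite !addr0 mulr0 subrr subr0 normr0 mulr0.
have := Hu u0; rewrite /GRing.scale/= mulr1.
rewrite -(ler_pM2l (x := `|u|)) ?normr_gt0// -normrM mulrBr mulrA divff// mul1r.
by rewrite mulrC distrC [u + t]addrC [`|u| * e]mulrC -['D_1 h t]/(lim _).
Qed.

Lemma approx_slope_le h (t r e : R) :
  (forall d, 0 < d -> approx_at h t ( *%R r) d) -> slope_le h e t -> `|r| <= e.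
Proof.
move=> hr he; apply/ler_addgt0Pr => d d0.
have d20 : 0 < d / 2 by rewrite divr_gt0.
have [u [u0 H1 H2]] : exists u : R, [/\ u != 0,
    `|h (t + u) - h t| <= (e + d / 2) * `|u| &
    `|h (t + u) - h t - r * u| <= d / 2 * `|u|].
  have /nbhs_ballP[x /= x0 H1] := he _ d20.
  have /nbhs_ballP[y /= y0 H2] := hr _ d20.
  pose u := Num.min x y / 2.
  have u0 : 0 < u by rewrite divr_gt0// lt_min x0.
  have uxy : u < Num.min x y by rewrite ltr_pdivrMr// ltr_pMr ?ltr1n// lt_min x0.
  have uB z : Num.min x y <= z -> ball (0 : R) z u.
    by move=> mz; rewrite /ball/= sub0r normrN gtr0_norm// (lt_le_trans uxy).
  exists u; split; first by rewrite gt_eqF.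
  - by apply: H1; apply: uB; rewrite ge_min lexx.
  - by apply: H2; apply: uB; rewrite ge_min lexx orbT.
rewrite -(ler_pM2r (x := `|u|)) ?normr_gt0// -normrM.
rewrite (_ : r * u = (h (t + u) - h t) - (h (t + u) - h t - r * u)); last by ring.
rewrite (le_trans (ler_normB _ _))// (le_trans (lerD H1 H2))//.
by rewrite -mulrDl ler_wpM2r//; lra.
Qed.

(** Lebesgue differentiation: at almost every point the integral of [rho] has derivative [rho t],
    and near an interior point [h] differs from this integral by a constant. *)
Lemma lipschitz_ftc h L (a b : R) : lipschitz_with L h -> a < b ->
  exists rho : R -> R, [/\ mu.-integrable [set: R] (EFin \o rho),
    h b - h a = (\int[mu]_(t in `]a, b]) rho t)%R &
    mu.-negligible [set t | a < t < b /\ ~ is_derive t 1 h (rho t)]].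
Proof.
move=> hL ab; have [rho [irho rhoE]] := lipschitz_integral hL ab.
exists rho; split => //; first by rewrite rhoE// (ltW ab) lexx.
have irho' y : mu.-integrable [set` Interval (BRight a) (BRight y)] (EFin \o rho).
  exact: (integrableS measurableT).
have := FTC1 irho' (open_integrable_locally openT irho).
apply: negligibleS => t /= [/andP[at_ tb]]; apply: contra_not.
move=> /(_ _)[]; first by rewrite lte_fin.
move=> dF Ft.
have : is_derive t 1 (fun x => h a + \int[mu]_(y in `]a, x]) rho y) (rho t).
  rewrite -[rho t]add0r; apply: is_deriveD; rewrite -Ft derive1E.
  exact/derivableP.
apply: near_eq_is_derive; near=> x.
rewrite -rhoE; first by rewrite addrC subrK.
apply/andP; split; apply: ltW.
  by near: x; exact: lt_nbhsr.
by near: x; exact: lt_nbhsl.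
Unshelve. all: by end_near. Qed.

(** The density is produced on bounded intervals only, so the line is exhausted by the intervals
    []-(n+1), n+1[]. This is Rademacher's theorem in dimension one. *)
Lemma lipschitz_ae_approx h L : lipschitz_with L h ->
  mu.-negligible [set t | ~ exists r : R, forall e, 0 < e -> approx_at h t ( *%R r) e].
Proof.
move=> hL.
pose N n := [set t | - n.+1%:R < t < n.+1%:R /\
  ~ exists r : R, forall e, 0 < e -> approx_at h t ( *%R r) e].
suff : mu.-negligible (\bigcup_n N n).
  apply: negligibleS => t /= Ht; exists (Num.truncn `|t|) => //; split=> //.
  by rewrite -ltr_norml truncnS_gt.
apply: negligible_bigcup => n.
have [|rho [_ _]] := @lipschitz_ftc h L (- n.+1%:R) n.+1%:R hL.
  by rewrite gtrN// ltr0n.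
apply: negligibleS => t [tn H]; split => //.
apply: contra_not H => H; exists (rho t) => e e0; exact: derive1_approx.
Qed.

(** Off a null set the derivative exists and equals the density, whose modulus is then at most [e];
    integrating the density gives the bound. *)
Lemma lipschitz_ae_slope_le h L (N : set R) (a b e : R) :
  lipschitz_with L h -> a <= b ->
  0 <= e -> mu.-negligible N ->
  (forall t, a < t < b -> ~ N t -> slope_le h e t) ->
  `|h b - h a| <= e * (b - a).
Proof.
move=> hL; rewrite le_eqVlt => /predU1P[->|ab e0 N0 he].
  by rewrite !subrr normr0 mulr0.
have [rho [irho rhoE rhoN]] := lipschitz_ftc hL ab.
have irho' : mu.-integrable `]a, b]%classic (EFin \o rho).
  exact: (integrableS measurableT).
rewrite -lee_fin rhoE EFin_normr_Rintegral//.
apply: (le_trans (le_abse_integral _ _ _)) => //.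
  by case/integrableP : irho'.
apply: (@le_trans _ _ (e%:E * mu `]a, b]%classic)%E).
  apply: integral_le_bound => //; first by case/integrableP : irho'.
  (* The interval of integration contains [b], where no slope bound is assumed; this point joins the
     null set. *)
  have Nb : mu.-negligible [set b].
    by apply/negligibleP => //; exact: lebesgue_measure_set1.
  have := negligibleU Nb (negligibleU N0 rhoN).
  apply: negligibleS => t /= /not_implyP[]; rewrite in_itv/= => /andP[at_ tb].
  rewrite lee_fin => /negP; rewrite -ltNge => H.
  move: tb; rewrite le_eqVlt => /predU1P[->|tb]; [by left|right].
  have [|Nt] := pselect (N t); [by left|right]; split; first by rewrite at_ tb.
  move=> rt; move: H; rewrite ltNge => /negP; apply.
  apply: (@approx_slope_le h t); last by apply: he => //; rewrite at_ tb.
  by move=> d d0; exact: derive1_approx.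
by rewrite lebesgue_measure_itv/= lte_fin ab -EFinB -EFinM.
Qed.

Lemma closed_ae_dense_at (E : set R) (eta : R) : closed E -> 0 < eta ->
  mu.-negligible [set t | E t /\
    ~ \forall s \near (0 : R), exists2 s', `|s' - s| <= eta * `|s| & E (t + s')].
Proof.
move=> cE eta0.
have mE : measurable (E : set (measurableTypeR R)) by exact: closed_measurable.
(* A hole of E of relative size eta next to t bounds the density of E in a
   ball around t away from 1. *)
have := lebesgue_density mE; apply: negligibleS => t /= [Et]; apply: contra_not.
rewrite indicE mem_set// => /fine_cvgP[_] /cvgrPdist_lt.
(* The share of a hole of radius [eta * |s|] in the ball of radius [(1 + eta) * |s|] that contains
   it. *)
pose k := eta / (1 + eta).
have k0 : 0 < k by rewrite divr_gt0// addr_gt0.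
move=> /(_ _ k0); rewrite /= near_withinE => /nbhs_ballP[d /= d0 H].
have eta1 : 0 < 1 + eta by rewrite addr_gt0.
apply/nbhs_ballP; exists (d / (1 + eta)) => /=; first by rewrite divr_gt0.
move=> s; rewrite /ball/= sub0r normrN ltr_pdivlMr// => sd.
have [->|s0] := eqVneq s 0.
  by exists 0; rewrite ?addr0// subrr normr0 mulr0.
apply: contrapT => /forall2NP noE.
have ns0 : 0 < `|s| by rewrite normr_gt0.
pose r := (1 + eta) * `|s|.
have r0 : 0 < r by rewrite mulr_gt0.
have rd : ball (0 : R) d r.
  by rewrite /ball/= sub0r normrN gtr0_norm// /r mulrC.
have := H r rd r0.
suff Hm : (mu (E `&` ball t r) <= (2 * r - 2 * eta * `|s|)%:E)%E.
  have fm : (mu (E `&` ball t r)) \is a fin_num.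
    by rewrite ge0_fin_numE//; exact: le_lt_trans Hm (ltry _).
  move: Hm; rewrite -(fineK fm) lee_fin => Hm.
  rewrite lebesgue_measure_ball; last exact: ltW.
  rewrite inver mulrn_eq0/= gt_eqF//.
  rewrite -EFinM/= => /(le_lt_trans (ler_norm _)).
  rewrite ltrBlDr -ltrBlDl ltr_pdivlMr ?mulrn_wgt0// => /lt_le_trans/(_ Hm).
  rewrite /k /r -mulr_natl; apply/negP; rewrite -leNgt.
  rewrite le_eqVlt; apply/orP; left; apply/eqP; field.
  by rewrite gt_eqF.
have sr : ball t r `\` ball (t + s) (eta * `|s|) `<=` setT by [].
have sub : ball (t + s) (eta * `|s|) `<=` ball t r.
  move=> y; rewrite /ball/= => Hy.
  rewrite /r mulrDl mul1r [ltRHS]addrC.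
  rewrite (_ : t - y = t + s - y - s); last by ring.
  by rewrite (le_lt_trans (ler_normB _ _))// ltrD2r.
apply: (@le_trans _ _ (mu (ball t r `\` ball (t + s) (eta * `|s|)))).
  apply: le_measure; rewrite ?inE//.
  - by apply: measurableI => //; exact: measurable_ball.
  - by apply: measurableD; exact: measurable_ball.
  move=> y [Ey ty]; split => //; rewrite /ball/= => Hy.
  have [|] := noE (y - t); last by rewrite addrCA subrr addr0.
  by apply; rewrite (_ : y - t - s = - (t + s - y)) ?normrN ?ltW//; ring.
rewrite measureD//; [|exact: measurable_ball|exact: measurable_ball|].
  have -> : ball t r `&` ball (t + s) (eta * `|s|) = ball (t + s) (eta * `|s|).
    exact/setIidr.
  change (mu (ball t r) - mu (ball (t + s)%R (eta * `|s|)%R) <=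
    (2 * r - 2 * eta * `|s|)%:E)%E.
  rewrite lebesgue_measure_ball; last exact: ltW.
  rewrite lebesgue_measure_ball; last by rewrite ltW// mulr_gt0.
  rewrite -EFinB lee_fin -(mulr_natl r) -(mulr_natl (eta * _)) !mulrA; exact: lexx.
change (mu (ball t r) < +oo)%E.
by rewrite lebesgue_measure_ball ?ltry//; exact: ltW.
Qed.

End OneDim.

(** * Rademacher's theorem and the mean value inequality *)

Section ProductNull.
Context {R : realType} {d1 d2} {T1 : measurableType d1} {T2 : measurableType d2}.
Variables (m1 : {sigma_finite_measure set T1 -> \bar R})
          (m2 : {sigma_finite_measure set T2 -> \bar R}).
Local Open Scope ereal_scope.

Lemma product_measure12E (M : set (T1 * T2)) : measurable M ->
  (m1 \x m2) M = (m1 \x^ m2) M.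
Proof.
by apply: product_measure_unique => A B mA mB; exact: product_measure2E.
Qed.

(** Fubini: the measure of [M] is the integral of the measures of its sections. Measurability of [M]
    enters here, which is why the exceptional sets below are built from closed sets. *)
Lemma product_null_xsection (M : set (T1 * T2)) : measurable M ->
  (forall x, m2.-negligible (xsection M x)) -> (m1 \x m2).-negligible M.
Proof.
move=> mM M0; apply/negligibleP => //; rewrite /product_measure1.
apply: integral0_eq => x _ /=; apply: measure_negligible => //.
exact: measurable_xsection.
Qed.

Lemma product_null_ysection (M : set (T1 * T2)) : measurable M ->
  (forall y, m1.-negligible (ysection M y)) -> (m1 \x m2).-negligible M.
Proof.
move=> mM M0; apply/negligibleP => //=; rewrite product_measure12E//.
rewrite /product_measure2.
apply: integral0_eq => x _ /=; apply: measure_negligible => //.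
exact: measurable_ysection.
Qed.

Lemma null_integral_ae d (T : measurableType d)
    (m : {measure set T -> \bar R}) (f : T -> \bar R) :
  measurable_fun setT f -> (forall x, 0 <= f x) -> \int[m]_x f x = 0 ->
  m.-negligible [set x | f x != 0].
Proof.
move=> mf f0 If.
have : \int[m]_(x in setT) `|f x| = 0.
  by rewrite -[RHS]If; apply: eq_integral => x _; rewrite gee0_abs.
move/(ae_eq_integral_abs _ measurableT mf).
by apply: negligibleS => x /= /eqP fx0; apply: contra_not fx0; exact.
Qed.

(** A null set may fail to be measurable; Fubini is applied to a measurable null set that contains
    it. *)
Lemma negligible_xsection (N : set (T1 * T2)) : (m1 \x m2).-negligible N ->
  m1.-negligible [set x | ~ m2.-negligible (xsection N x)].
Proof.
move=> [M [mM M0 NM]].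
have := null_integral_ae (measurable_fun_xsection m2 mM) (fun x => measure_ge0 _ _) M0.
apply: negligibleS => x /=; apply: contra_not_neq => /= M0x.
apply: (negligibleS (A := xsection M x)); first exact: le_xsection.
by apply/negligibleP => //; exact: measurable_xsection.
Qed.

Lemma negligible_ysection (N : set (T1 * T2)) : (m1 \x m2).-negligible N ->
  m2.-negligible [set y | ~ m1.-negligible (ysection N y)].
Proof.
move=> [M [mM M0 NM]]; move: M0; rewrite /= product_measure12E// => M0.
have := null_integral_ae (measurable_fun_ysection m1 mM) (fun x => measure_ge0 _ _) M0.
apply: negligibleS => x /=; apply: contra_not_neq => /= M0x.
apply: (negligibleS (A := ysection M x)); first exact: le_ysection.
by apply/negligibleP => //; exact: measurable_ysection.
Qed.

(* In the library, the instance for products of subprobabilities masks the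
   sigma-finite structure of a general product measure. *)
Definition product_sigma_finite_measure : set (T1 * T2) -> \bar R := m1 \x m2.

HB.instance Definition _ := Measure.copy product_sigma_finite_measure (m1 \x m2).

Let product_sigma_finite : sigma_finite setT product_sigma_finite_measure.
Proof.
have /sigma_finiteP[F [TF ndF Foo]] := sigma_finiteT m1.
have /sigma_finiteP[G [TG ndG Goo]] := sigma_finiteT m2.
exists (fun n => F n `*` G n) => [|n].
  apply/seteqP; split => // -[x y] _.
  have [i _ Fx] : (\bigcup_n F n) x by rewrite -TF.
  have [j _ Gy] : (\bigcup_n G n) y by rewrite -TG.
  exists (maxn i j) => //; split => /=.
    by move: x Fx {Gy}; apply/subsetPset/ndF; rewrite leq_maxl.
  by move: y Gy {Fx}; apply/subsetPset/ndG; rewrite leq_maxr.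
have [[mF Fn] [mG Gn]] := (Foo n, Goo n).
split; first exact: measurableX.
rewrite /product_sigma_finite_measure product_measure1E//.
by rewrite lte_mul_pinfty// ge0_fin_numE.
Qed.

HB.instance Definition _ :=
  Measure_isSigmaFinite.Build _ _ _ product_sigma_finite_measure product_sigma_finite.

End ProductNull.

(* The Lebesgue measure of V is carried by an auxiliary measurable space T
   through phi, so that V need not be equipped with a measurable structure.
   Differentiability is expressed through a countable family q of bounded
   linear forms, which keeps the sets of interest Borel. *)
Record rademacher_space {R : realType} (V : normedModType R) := RademacherSpace {
  rad_d : measure_display ;
  rad_T : measurableType rad_d ;
  rad_mu : {sigma_finite_measure set rad_T -> \bar R} ;
  rad_phi : rad_T -> V ;
  rad_B : nat -> set V ;
  rad_q : nat -> V -> R ;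
  rad_C : R ;
  rad_B_open : forall i, open (rad_B i) ;
  rad_B_basis : forall (O : set V) x, open O -> O x ->
    exists i, rad_B i x /\ rad_B i `<=` O ;
  rad_B_measurable : forall i, measurable (rad_phi @^-1` rad_B i) ;
  rad_q_linear : forall i, linear (rad_q i) ;
  rad_q_bounded : forall i, exists k, forall u, `|rad_q i u| <= k * `|u| ;
  rad_open : forall (O : set V) x, open O -> O x ->
    ~ rad_mu.-negligible (rad_phi @^-1` O) ;
  rad_diff : forall (g : V -> R) L, lipschitz_with L g ->
    rad_mu.-negligible (rad_phi @^-1`
      [set x | ~ forall e, 0 < e -> exists i, approx_at g x (rad_q i) e]) ;
  rad_C_ge0 : 0 <= rad_C ;
  rad_mean_value : forall (g : V -> R) L (N : set V) x r e,
    lipschitz_with L g -> 0 <= e ->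
    rad_mu.-negligible (rad_phi @^-1` N) ->
    (forall y, ball x r y -> ~ N y -> slope_le g e y) ->
    forall y z, ball x r y -> ball x r z -> `|g y - g z| <= rad_C * e * `|y - z|
}.

Arguments rad_phi {R V} _ _.

Section RademacherBase.
Context {R : realType}.

(** Base of the induction. [V] is a single point, so the carrier only has to have nonzero measure;
    the constant of the mean value inequality starts at 0. *)
Definition rademacher_trivial (V : normedModType R) : (forall x : V, x = 0) ->
  rademacher_space V.
Proof.
move=> V0.
have eqV (x y : V) : x = y by rewrite [x]V0 [y]V0.
apply: (@RademacherSpace R V _ (measurableTypeR R) (@lebesgue_measure R)
  (fun=> 0) (fun=> setT) (fun _ _ => 0) 0) => //.
- by move=> _; exact: openT.
- move=> O x oO Ox; exists 0%N; split => // y _; by rewrite (eqV y x).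
- by move=> _; rewrite preimage_setT; exact: measurableT.
- by move=> _ a u v; rewrite scaler0 addr0.
- by move=> _; exists 0 => u; rewrite normr0 mul0r.
- move=> O x oO Ox [A [mA A0 OA]].
  have AT : A = setT.
    apply/seteqP; split => // t _; apply: OA.
    by rewrite /preimage/= (eqV 0 x).
  have : @lebesgue_measure R [set: R] = 0%E by rewrite -AT.
  by rewrite -set_itvNyy lebesgue_measure_itv/=.
- move=> g L _; apply: negligibleS (negligible_set0 _) => x /=; apply.
  move=> e e0; exists 0%N; apply: nearW => u.
  by rewrite (eqV (0 + u) 0) !subrr normr0 mulr_ge0// ltW.
- move=> g L N x r e _ _ _ _ y z _ _.
  by rewrite (eqV y z) !subrr !normr0 mulr0.
Qed.

Lemma rad_dense (V : normedModType R) (S : rademacher_space V)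
    (A : set (rad_T S)) (O : set V) x : (rad_mu S).-negligible A ->
  open O -> O x -> exists a, O (rad_phi S a) /\ ~ A a.
Proof.
move=> A0 oO Ox; apply: contrapT => H; have := @rad_open _ _ S O x oO Ox; apply.
by apply: negligibleS A0 => a Oa; apply: contrapT => Aa; apply: H; exists a.
Qed.

(** For each [w] the condition on [p] is closed, and closedness survives the possibly uncountable
    intersection over [D], where measurability would not. *)
Lemma closed_approx (W : normedModType R) (g : W -> R) L (D : set W)
    (c b : W -> R) : lipschitz_with L g ->
  closed [set p | forall w, D w -> `|g (p + w) - g p - c w| <= b w].
Proof.
move=> gL; pose F w := [set p | `|g (p + w) - g p - c w| <= b w].
have -> : [set p | forall w, D w -> `|g (p + w) - g p - c w| <= b w] =
  \bigcap_(w in D) F w by [].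
apply: closed_bigI => w _.
have cg : continuous (fun p => `|g (p + w) - g p - c w|).
  move=> p; apply: cvg_norm; apply: cvgB; last exact: cvg_cst.
  apply: cvgB; last exact: (lipschitz_with_continuous gL).
  apply: (cvg_comp (fun p => p + w) g); last exact: (lipschitz_with_continuous gL).
  by apply: cvgD; [exact: cvg_id|exact: cvg_cst].
rewrite /F (_ : [set p | _] = (fun p => `|g (p + w) - g p - c w|) @^-1` [set x | x <= b w])//.
by apply: closed_comp => [p _|]; [exact: cg|exact: closed_le].
Qed.

End RademacherBase.

Lemma negligible_bigcup_countType d (T : measurableType d) (R : realType)
    (m : {measure set T -> \bar R}) (I : countType) (F : I -> set T) :
  (forall i, m.-negligible (F i)) -> m.-negligible (\bigcup_i F i).
Proof.
move=> F0; pose G n := if unpickle n is Some i then F i else set0.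
suff : m.-negligible (\bigcup_n G n).
  apply: negligibleS => x [i _ Fx]; exists (pickle i) => //.
  by rewrite /G pickleK.
apply: negligible_bigcup => n; rewrite /G.
by case: unpickle => [i|]; [exact: F0|exact: negligible_set0].
Qed.

Lemma inv_succ_le {R : realType} (e : R) : 0 < e ->
  exists n : nat, n.+1%:R^-1 <= e.
Proof.
move=> e0; exists (Num.truncn e^-1).
by rewrite invf_ple ?posrE// ltW// truncnS_gt.
Qed.

(** Neighborhoods of 0 indexed by an integer: a property that holds near 0 becomes a countable union
    of conditions at a fixed radius. *)
Lemma near0P {R : realType} (V : normedModType R) (P : V -> Prop) :
  (\forall u \near (0 : V), P u) <->
  exists n : nat, forall u, `|u| <= n.+1%:R^-1 -> P u.
Proof.
split=> [/nbhs_ballP[d /= d0 H]|[n H]].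
  have [n nd] := inv_succ_le (divr_gt0 d0 (ltr0n _ 2)).
  exists n => u un; apply: H; rewrite -ball_normE/= sub0r normrN.
  by rewrite (le_lt_trans un)// (le_lt_trans nd)// ltr_pdivrMr// ltr_pMr// ltr1n.
apply/nbhs_ballP; exists n.+1%:R^-1 => /=; first by rewrite invr_gt0.
by move=> u; rewrite -ball_normE/= sub0r normrN => /ltW /H.
Qed.

Lemma open_setX {X Y : topologicalType} (A : set X) (B : set Y) :
  open A -> open B -> open (A `*` B).
Proof.
rewrite !openE => oA oB p [Ap Bp]; exists (A, B) => //=; split.
  exact: oA.
exact: oB.
Qed.

(** A union of closed sets indexed by [s], kept closed by compactness of [I]: a point outside has
    one neighborhood that avoids [E] for all shifts at once. *)
Lemma closed_shift_compact {R : realType} {V : normedModType R} (E : set (V * R))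
    (I : set R) : closed E -> compact I ->
  closed [set p | exists2 s, I s & E (p + (0, s))].
Proof.
move=> cE /compact_near_coveringP cI; rewrite -openC openE => p /= Hp.
have : \forall p' \near p, I `<=` (fun s => ~ E (p' + (0, s))).
  apply: (cI _ (nbhs p) (fun p' s => ~ E (p' + (0, s)))) => s Is.
  have nE : ~ E (p + (0, s)) by move=> H; apply: Hp; exists s.
  have cf : (fun q : R * (V * R) => q.2 + ((0 : V), q.1)) x @[x --> (s, p)] -->
      p + ((0 : V), s).
    apply: cvgD; first exact: cvg_snd.
    by apply: (@cvg_pair _ _ _ _ (nbhs (0 : V)) (nbhs s));
      [exact: cvg_cst|exact: cvg_fst].
  suff : nbhs (p + ((0 : V), s)) (~` E) by exact: cf.
  apply: open_nbhs_nbhs; split => //.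
  exact: closed_openC.
by apply: filterS => p' Hp' [s Is]; exact: Hp'.
Qed.

(** * The induction step: from [V] to [V * R] *)

Section RademacherProduct.
Context {R : realType} {V : normedModType R} (S : rademacher_space V).
Local Notation mu := (@lebesgue_measure R).
Local Notation T := (rad_T S * measurableTypeR R)%type.
Local Notation m := (rad_mu S \x mu)%E.

Definition prod_phi (p : T) : V * R := (rad_phi S p.1, p.2).

(** Boxes with a rational interval as second factor, enumerated by [unpickle]; numbers that decode
    to nothing give the empty set. *)
Definition prod_B (n : nat) : set (V * R) :=
  if (unpickle n : option (nat * rat * rat)) is Some (i, a, b)
  then rad_B S i `*` `]ratr a, ratr b[ else set0.

(** Rational slopes along R keep the family countable; derivatives are only matched up to a
    tolerance. *)
Definition prod_q (n : nat) (p : V * R) : R :=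
  if (unpickle n : option (nat * rat)) is Some (i, a)
  then rad_q S i p.1 + ratr a * p.2 else 0.

Lemma prod_B_open i : open (prod_B i).
Proof.
rewrite /prod_B; case: unpickle => [[[j a] b]|]; last exact: open0.
by apply: open_setX; [exact: rad_B_open|exact: interval_open].
Qed.

Lemma prod_B_basis (O : set (V * R)) p : open O -> O p ->
  exists i, prod_B i p /\ prod_B i `<=` O.
Proof.
move=> oO Op; have [[A B]/= [nA nB] AB] : nbhs p O := open_nbhs_nbhs (conj oO Op).
have [i [Bi BA]] := rad_B_basis S (@open_interior _ A) nA.
have /nbhs_ballP[d /= d0 dB] := nB.
have [a] := @rat_in_itvoo _ (p.2 - d) p.2 (ltac:(by rewrite ltrBlDr ltrDl)).
have [b] := @rat_in_itvoo _ p.2 (p.2 + d) (ltac:(by rewrite ltrDl)).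
rewrite !in_itv/= => /andP[pb bd] /andP[da ap].
exists (pickle (i, a, b)); rewrite /prod_B pickleK; split.
  by split => //=; rewrite in_itv/= ap.
move=> -[x t] /= [Bx]; rewrite in_itv/= => /andP[at_ tb]; apply: AB; split => /=.
  by apply: (@interior_subset _ A); exact: BA.
apply: dB; rewrite /ball/= ltr_distlC.
by rewrite (lt_trans da)//= (lt_trans tb).
Qed.

Lemma prod_B_measurable i : measurable (prod_phi @^-1` prod_B i).
Proof.
rewrite /prod_B; case: unpickle => [[[j a] b]|]; last first.
  by rewrite preimage_set0; exact: measurable0.
rewrite (_ : _ @^-1` _ = (rad_phi S @^-1` rad_B S j) `*` `]ratr a, ratr b[)//.
by apply: measurableX; [exact: rad_B_measurable|exact: measurable_itv].
Qed.

(** An open set is the union of the countably many basis boxes it contains; this takes the place of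
    a Borel structure on [V * R]. *)
Lemma prod_closed_measurable (F : set (V * R)) : closed F ->
  measurable (prod_phi @^-1` F).
Proof.
move=> cF; suff : measurable (prod_phi @^-1` (~` F)).
  by rewrite preimage_setC => /measurableC; rewrite setCK.
have -> : ~` F = \bigcup_(i in [set i | prod_B i `<=` ~` F]) prod_B i.
  apply/seteqP; split => [x Fx|x [i iF Bx]]; last exact: iF.
  by have [i [Bx iO]] := prod_B_basis (closed_openC cF) Fx; exists i.
rewrite preimage_bigcup; apply: bigcup_measurable => i _.
exact: prod_B_measurable.
Qed.

Lemma prod_q_linear i : linear (prod_q i).
Proof.
rewrite /prod_q; case: unpickle => [[j a]|] c x y /=; last by rewrite scaler0 addr0.
rewrite rad_q_linear/= /GRing.scale/=; ring.
Qed.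

Lemma prod_q_bounded i : exists k, forall u, `|prod_q i u| <= k * `|u|.
Proof.
rewrite /prod_q; case: unpickle => [[j a]|]; last first.
  by exists 0 => u; rewrite normr0 mul0r.
have [k hk] := rad_q_bounded S j; exists (`|k| + `|ratr a|) => u.
rewrite (le_trans (ler_normD _ _))// mulrDl lerD//.
  rewrite (le_trans (hk _))// (@le_trans _ _ (`|k| * `|u.1|))//.
    by rewrite ler_wpM2r// ler_norm.
  by rewrite ler_wpM2l// prod_normE le_max lexx.
by rewrite normrM ler_wpM2l// prod_normE le_max lexx orbT.
Qed.

(** Otherwise almost every section of a box would be null. The points with null section are dense,
    whereas over the first factor every section is an interval of positive length. *)
Lemma prod_open (O : set (V * R)) p : open O -> O p ->
  ~ m.-negligible (prod_phi @^-1` O).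
Proof.
move=> oO Op; have [n [+ BO]] := prod_B_basis oO Op.
rewrite /prod_B; case En : (unpickle n : option (nat * rat * rat)) => [[[i a] b]|//].
move=> [/= Bi]; rewrite in_itv/= => /andP[ap pb].
move=> /(negligibleS (B := prod_phi @^-1` prod_B n)) H.
have /negligible_xsection : m.-negligible (prod_phi @^-1` prod_B n).
  by apply: H => q; exact: BO.
move=> /(rad_dense (S := S)) /(_ (rad_B_open S i) Bi)[c [Bc /contrapT]].
rewrite xsectionE => -[A [mA A0 sA]].
have mI : measurable (`]ratr a, ratr b[%classic : set (measurableTypeR R)).
  exact: measurable_itv.
have : (mu `]ratr a, ratr b[%classic <= mu A)%E.
  apply: le_measure; rewrite ?inE//.
  move=> t tab; apply: sA.
  by rewrite /preimage/= /prod_B En.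
rewrite A0 lebesgue_measure_itv/= lte_fin (lt_trans ap pb) -EFinB lee_fin.
by rewrite subr_le0 leNgt (lt_trans ap pb).
Qed.

Lemma lipschitz_with_fst L (g : V * R -> R) (t : R) : lipschitz_with L g ->
  lipschitz_with L (fun x => g (x, t)).
Proof.
move=> gL x y; apply: (le_trans (gL _ _)).
by rewrite prod_normE/= subrr normr0 max_l.
Qed.

Lemma lipschitz_with_snd L (g : V * R -> R) (x : V) : lipschitz_with L g ->
  lipschitz_with L (fun t => g (x, t)).
Proof.
move=> gL s t; apply: (le_trans (gL _ _)).
by rewrite prod_normE/= subrr normr0 max_r.
Qed.

Let addpE (p : V * R) u s : p + (u, s) = (p.1 + u, p.2 + s).
Proof. by []. Qed.

Let subpE (x y : V) (s t : R) : (x, s) - (y, t) = (x - y, s - t).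
Proof. by []. Qed.

Section Diff.
Variables (g : V * R -> R) (L : R).
Hypothesis gL : lipschitz_with L g.

(** Approximate partial differentiability along [V] for [E1], along R for [E2]; radius and tolerance
    are fixed so that the sets are closed. *)
Let E1 (i n k : nat) : set (V * R) := [set p | forall w,
  (w.2 = 0 /\ `|w| <= n.+1%:R^-1) ->
  `|g (p + w) - g p - rad_q S i w.1| <= k.+1%:R^-1 * `|w|].

Let E2 (r : rat) (n k : nat) : set (V * R) := [set p | forall w,
  (w.1 = 0 /\ `|w| <= n.+1%:R^-1) ->
  `|g (p + w) - g p - ratr r * w.2| <= k.+1%:R^-1 * `|w|].

(** [E1] leaves no large hole along R next to [p]: it can be reached from [p + (0, s)] by a shift
    that is small relative to [s]. *)
Let G (i n k l : nat) : set (V * R) := [set p | forall s : R,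
  `|s| <= l.+1%:R^-1 ->
  exists2 s', `|s' - s| <= k.+1%:R^-1 * `|s| & E1 i n k (p + (0, s'))].

Let closed_E1 i n k : closed (E1 i n k).
Proof. exact: closed_approx gL. Qed.

Let closed_E2 i n k : closed (E2 i n k).
Proof. exact: closed_approx gL. Qed.

Let closed_G i n k l : closed (G i n k l).
Proof.
have -> : G i n k l = \bigcap_(s in [set s : R | `|s| <= l.+1%:R^-1])
  [set p | exists2 s', `[s - k.+1%:R^-1 * `|s|, s + k.+1%:R^-1 * `|s|]%classic s'
    & E1 i n k (p + (0, s'))].
  apply/seteqP; split => p Hp s /Hp[s' H1 H2]; exists s' => //.
    by move: H1; rewrite /= in_itv/= distrC ler_distlC.
  by move: H1; rewrite /= in_itv/= distrC ler_distlC.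
apply: closed_bigI => s _; apply: closed_shift_compact => //.
exact: segment_compact.
Qed.

(** Exceptional points at tolerance [1/(k+1)]: no approximate derivative along [V], none along R, or
    a point of [E1] around which [E1] is not dense enough along R. *)
Let B1 k := ~` \bigcup_(j : nat * nat) E1 j.1 j.2 k.
Let B2 k := ~` \bigcup_(j : rat * nat) E2 j.1 j.2 k.
Let B3 (j : nat * nat * nat) :=
  E1 j.1.1 j.1.2 j.2 `&` ~` \bigcup_l G j.1.1 j.1.2 j.2 l.

Let measurable_setC_bigcup (I : countType) (F : I -> set (V * R)) :
  (forall i, closed (F i)) -> measurable (prod_phi @^-1` (~` \bigcup_i F i)).
Proof.
move=> cF; change (measurable (~` \bigcup_i (prod_phi @^-1` F i))).
apply: measurableC; apply: countable_bigcupT_measurable => // i.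
exact: prod_closed_measurable.
Qed.

Let mB1 k : measurable (prod_phi @^-1` B1 k).
Proof. by apply: measurable_setC_bigcup => j; exact: closed_E1. Qed.

Let mB2 k : measurable (prod_phi @^-1` B2 k).
Proof. by apply: measurable_setC_bigcup => j; exact: closed_E2. Qed.

Let mB3 j : measurable (prod_phi @^-1` B3 j).
Proof.
rewrite /B3 preimage_setI; apply: measurableI.
  by apply: prod_closed_measurable; exact: closed_E1.
by apply: measurable_setC_bigcup => l; exact: closed_G.
Qed.

Let B1_null k : m.-negligible (prod_phi @^-1` B1 k).
Proof.
apply: product_null_ysection => [|t]; first exact: mB1.
apply: negligibleS (@rad_diff _ _ S _ _ (lipschitz_with_fst t gL)) => a /=.
rewrite ysectionE /preimage/= => Ba H; apply: Ba.
have [i /near0P[n Hn]] := H k.+1%:R^-1 (ltac:(by rewrite invr_gt0)).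
exists (i, n) => // -[u s] /= [-> un].
have := Hn u; rewrite addpE /= addr0.
by move: un; rewrite prod_normE/= normr0 max_l// => un; exact.
Qed.

Let B2_null k : m.-negligible (prod_phi @^-1` B2 k).
Proof.
apply: product_null_xsection => [|x]; first exact: mB2.
apply: negligibleS (lipschitz_ae_approx (lipschitz_with_snd (rad_phi S x) gL)) => t /=.
rewrite xsectionE /preimage/= => Ba [r H]; apply: Ba.
(* Half of the tolerance is spent on replacing the slope [r] by a rational one. *)
have k20 : 0 < k.+1%:R^-1 / 2 :> R by rewrite divr_gt0.
have [q] := @rat_in_itvoo _ (r - k.+1%:R^-1 / 2) (r + k.+1%:R^-1 / 2)
  (ltac:(by rewrite ltrD2l gtrN)).
rewrite in_itv/= -ltr_distlC => rq.
have /near0P[n Hn] := H _ k20.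
exists (q, n) => // -[u s] /= [-> un].
have := Hn s; rewrite addpE /= addr0.
move: un; rewrite prod_normE/= normr0 max_r// => un /(_ un) Hs.
rewrite (_ : _ - _ = g (rad_phi S x, t + s) - g (rad_phi S x, t) - r * s +
  (r - ratr q) * s); last by ring.
rewrite (le_trans (ler_normD _ _))//.
rewrite [leRHS](_ : _ = k.+1%:R^-1 / 2 * `|s| + k.+1%:R^-1 / 2 * `|s|);
  last by field.
by rewrite lerD// normrM ler_wpM2r// ltW.
Qed.

(** On each line along R the trace of [E1] is closed, hence leaves no large hole next to almost
    every one of its points. *)
Let B3_null j : m.-negligible (prod_phi @^-1` B3 j).
Proof.
apply: product_null_xsection => [|x]; first exact: mB3.
pose E := [set t | E1 j.1.1 j.1.2 j.2 (rad_phi S x, t)].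
have cE : closed E.
  apply: (@closed_comp _ _ (fun t => (rad_phi S x, t))) => // t _.
  by apply: (@cvg_pair _ _ _ _ (nbhs (rad_phi S x)) (nbhs t));
    [exact: cvg_cst|exact: cvg_id].
have k0 : 0 < j.2.+1%:R^-1 :> R by rewrite invr_gt0.
apply: negligibleS (closed_ae_dense_at cE k0) => t /=.
rewrite xsectionE /preimage/= => -[HE HG]; split => // /near0P[l Hl]; apply: HG.
exists l => // s sl; have [s' ss' Es'] := Hl _ sl; exists s' => //.
rewrite (_ : prod_phi (x, t) + (0, s') = (rad_phi S x, t + s'))//.
by rewrite addpE /= addr0.
Qed.

Lemma prod_diff : m.-negligible (prod_phi @^-1`
  [set p | ~ forall e, 0 < e -> exists i, approx_at g p (prod_q i) e]).
Proof.
have := negligibleU (negligible_bigcup_countType B1_null)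
  (negligibleU (negligible_bigcup_countType B2_null)
     (negligible_bigcup_countType B3_null)).
apply: negligibleS => a /= H; apply: contrapT => Ha; apply: H => e e0.
have L0 : 0 <= L.
  apply: (@lipschitz_with_ge0 _ _ _ L g ((0 : V), (1 : R)) gL).
  by rewrite xpair_eqE oner_eq0 andbF.
(* Error budget in units of [|(u, s)| / (k+1)]: the two detours between [s] and [s'] cost [L] each,
   the two partial approximations 1 each. *)
have [k ke] : exists k : nat, k.+1%:R^-1 * (2 * L + 2) <= e.
  have L20 : 0 < 2 * L + 2 by rewrite ltr_wpDl// mulr_ge0.
  have [k ke] := inv_succ_le (divr_gt0 e0 L20).
  by exists k; rewrite -ler_pdivlMr.
move: Ha => /not_orP[H1 /not_orP[H2 H3]].
have [[i n] _ /= E1i] : (\bigcup_(j : nat * nat) E1 j.1 j.2 k) (prod_phi a).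
  by apply: contrapT => H; apply: H1; exists k.
have [[r n'] _ /= E2r] : (\bigcup_(j : rat * nat) E2 j.1 j.2 k) (prod_phi a).
  by apply: contrapT => H; apply: H2; exists k.
have [l _ Gl] : (\bigcup_l G i n k l) (prod_phi a).
  by apply: contrapT => H; apply: H3; exists (i, n, k).
clear H1 H2 H3; move: (prod_phi a) E1i E2r Gl => p E1i E2r Gl.
exists (pickle (i, r)); apply/near0P; exists (maxn (maxn n n') l) => -[u s].
have inv_mono (c d : nat) : (c <= d)%N -> d.+1%:R^-1 <= c.+1%:R^-1 :> R.
  by move=> cd; rewrite lef_pV2 ?posrE// ler_nat ltnS.
rewrite prod_normE/= ge_max => /andP[un sn].
have {}un : `|u| <= n.+1%:R^-1.
  by rewrite (le_trans un)// inv_mono// !leq_max leqnn.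
have sn' : `|s| <= n'.+1%:R^-1.
  by rewrite (le_trans sn)// inv_mono// !leq_max leqnn orbT.
have sl : `|s| <= l.+1%:R^-1.
  by rewrite (le_trans sn)// inv_mono// !leq_max leqnn orbT.
(* Reach p + (u, s) by moving first along R, to a point p + (0, s') of E1 with
   s' close to s, and then along V. *)
have [s' ss' Es'] := Gl _ sl.
have Hu : `|g (p + (0, s') + (u, 0)) - g (p + (0, s')) -
    rad_q S i u| <= k.+1%:R^-1 * `|u|.
  have := Es' (u, 0); rewrite /= prod_normE/= normr0 max_l//.
  by apply.
have Hs : `|g (p + (0, s)) - g (p) - ratr r * s| <=
    k.+1%:R^-1 * `|s|.
  have := E2r (0, s); rewrite /= prod_normE/= normr0 max_r//.
  by apply.
have Hss : `|(0 : V, s' - s)| = `|s' - s| by rewrite prod_normE/= normr0 max_r.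
have Ha1 : `|g (p + (u, s)) - g (p + (0, s') + (u, 0))| <=
    L * (k.+1%:R^-1 * `|s|).
  apply: (le_trans (gL _ _)); apply: ler_wpM2l => //.
  rewrite (_ : _ - _ = - (0, s' - s)) ?normrN ?Hss//.
  rewrite (addpE _ u s) (addpE _ 0 s') (addpE _ u 0) subpE /= !addr0 subrr.
  by congr pair; rewrite /= ?oppr0//; ring.
have Ha2 : `|g (p + (0, s')) - g (p + (0, s))| <=
    L * (k.+1%:R^-1 * `|s|).
  apply: (le_trans (gL _ _)); apply: ler_wpM2l => //.
  rewrite (_ : _ - _ = (0, s' - s)) ?Hss//.
  by rewrite (addpE _ 0 s') (addpE _ 0 s) subpE /= addr0 subrr; congr pair; ring.
rewrite /prod_q pickleK/=.
rewrite (_ : _ - _ =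
  (g (p + (u, s)) - g (p + (0, s') + (u, 0))) +
  (g (p + (0, s') + (u, 0)) - g (p + (0, s')) - rad_q S i u) +
  (g (p + (0, s')) - g (p + (0, s))) +
  (g (p + (0, s)) - g (p) - ratr r * s)); last by ring.
have mu_ : `|u| <= Num.max `|u| `|s| by rewrite le_max lexx.
have ms_ : `|s| <= Num.max `|u| `|s| by rewrite le_max lexx orbT.
have M0 : 0 <= Num.max `|u| `|s| by rewrite le_max normr_ge0.
apply: (le_trans (ler_normD _ _)); apply: (le_trans (lerD (ler_normD _ _) Hs)).
apply: (le_trans (lerD (lerD (ler_normD _ _) Ha2) (lexx _))).
apply: (le_trans (lerD (lerD (lerD Ha1 Hu) (lexx _)) (lexx _))).
apply: (@le_trans _ _ (k.+1%:R^-1 * (2 * L + 2) * Num.max `|u| `|s|)); last first.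
  by rewrite ler_wpM2r.
have k0 : 0 <= k.+1%:R^-1 :> R by rewrite invr_ge0.
set K := k.+1%:R^-1 in k0 *; set M := Num.max _ _ in mu_ ms_ M0 *.
have h1 : L * (K * `|s|) <= L * (K * M) by rewrite ler_wpM2l// ler_wpM2l.
have h2 : K * `|u| <= K * M by rewrite ler_wpM2l.
have h3 : K * `|s| <= K * M by rewrite ler_wpM2l.
rewrite (_ : K * (2 * L + 2) * M = L * (K * M) + K * M + L * (K * M) + K * M).
  by rewrite !lerD.
by ring.
Qed.

End Diff.

Lemma lebesgue_dense (N O : set R) (t : R) : mu.-negligible N ->
  open O -> O t -> exists s, O s /\ ~ N s.
Proof.
move=> N0 oO Ot; apply: contrapT => H.
have [A [mA A0 OA]] : mu.-negligible O.
  by apply: negligibleS N0 => s Os; apply: contrapT => Ns; apply: H; exists s.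
have /nbhs_ballP[d /= d0 dO] : nbhs t O by exact: open_nbhs_nbhs.
have mB : measurable (ball t d : set (measurableTypeR R)) by exact: measurable_ball.
have : (mu (ball t d) <= mu A)%E.
  by apply: le_measure; rewrite ?inE// => s ts; apply: OA; exact: dO.
by rewrite A0 lebesgue_measure_ball ?(ltW d0)// lee_fin leNgt mulrn_wgt0.
Qed.

Lemma slope_le_fst (g : V * R -> R) e x t : slope_le g e (x, t) ->
  slope_le (fun x => g (x, t)) e x.
Proof.
move=> ge eta /ge /near0P[n Hn]; apply/near0P; exists n => u un.
by have := Hn (u, 0); rewrite addpE /= addr0 prod_normE/= normr0 max_l//; exact.
Qed.

Lemma slope_le_snd (g : V * R -> R) e x t : slope_le g e (x, t) ->
  slope_le (fun t => g (x, t)) e t.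
Proof.
move=> ge eta /ge /near0P[n Hn]; apply/near0P; exists n => u un.
by have := Hn (0, u); rewrite addpE /= addr0 prod_normE/= normr0 max_r//; exact.
Qed.

(** By Fubini almost every slice meets [N] in a null set; there the induction hypothesis along [V]
    and the one-variable estimate along R apply. Such slices are dense, so Lipschitz continuity
    carries both estimates to all slices; adding them turns [rad_C S] into [rad_C S + 1]. *)
Lemma prod_mean_value (g : V * R -> R) L (N : set (V * R)) p r e :
  lipschitz_with L g -> 0 <= e -> m.-negligible (prod_phi @^-1` N) ->
  (forall y, ball p r y -> ~ N y -> slope_le g e y) ->
  forall y z, ball p r y -> ball p r z ->
    `|g y - g z| <= (rad_C S + 1) * e * `|y - z|.
Proof.
move=> gL e0 N0 slope.
have L0 : 0 <= L.
  apply: (@lipschitz_with_ge0 _ _ _ L g ((0 : V), (1 : R)) gL).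
  by rewrite xpair_eqE oner_eq0 andbF.
have C0 := rad_C_ge0 S.
have H1 x y s : ball p.1 r x -> ball p.1 r y -> ball p.2 r s ->
    `|g (x, s) - g (y, s)| <= rad_C S * e * `|x - y|.
  move=> px py ps; apply/ler_addgt0Pr => d d0.
  have L1 : 0 < 2 * L + 1 by rewrite ltr_wpDl// mulr_ge0.
  (* Going from level [s] to a good level [s'] and back costs [L * |s - s'|] twice, at most [d] in
     all; the [+ 1] covers [L = 0]. *)
  have [s' [[/= ss' ps'] /contrapT Ns']] :
      exists s', (ball s (d / (2 * L + 1)) `&` ball p.2 r) s' /\
        ~ [set t | ~ (rad_mu S).-negligible (ysection (prod_phi @^-1` N) t)] s'.
    apply: (lebesgue_dense (t := s) (negligible_ysection N0)).
      by apply: openI; exact: ball_open.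
    by split => //; apply: ballxx; rewrite divr_gt0.
  have slope' z : ball p.1 r z -> ~ N (z, s') ->
      slope_le (fun x => g (x, s')) e z.
    by move=> pz Nz; apply: slope_le_fst; apply: slope.
  rewrite ysectionE in Ns'.
  have := @rad_mean_value _ _ S _ L [set x | N (x, s')] p.1 r e
    (lipschitz_with_fst s' gL) e0 Ns' slope' x y px py => Hxy.
  rewrite (_ : g (x, s) - g (y, s) = (g (x, s) - g (x, s')) +
    (g (x, s') - g (y, s')) + (g (y, s') - g (y, s))); last by ring.
  have dL : L * `|s - s'| <= d / 2.
    rewrite (@le_trans _ _ (L * (d / (2 * L + 1))))//.
      by rewrite ler_wpM2l// ltW.
    rewrite mulrA ler_pdivrMr// -subr_ge0.
    rewrite (_ : _ - _ = d / 2); last by field.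
    by rewrite divr_ge0// ltW.
  have h1 := lipschitz_with_snd x gL s s'; have h2 := lipschitz_with_snd y gL s s'.
  apply: (le_trans (ler_normD _ _)); apply: (le_trans (lerD (ler_normD _ _) (lexx _))).
  rewrite [X in _ + X <= _]distrC; lra.
have H2 x s t : ball p.1 r x -> ball p.2 r s -> ball p.2 r t ->
    `|g (x, s) - g (x, t)| <= e * `|s - t|.
  move=> px.
  wlog st : s t / s <= t.
    move=> H ps pt; have [st|/ltW ts] := leP s t; first exact: H.
    by rewrite distrC [`|s - t|]distrC; exact: H.
  move=> ps pt; apply/ler_addgt0Pr => d d0.
  have L1 : 0 < 2 * L + 1 by rewrite ltr_wpDl// mulr_ge0.
  have [a [[xa pa] /contrapT Na]] :
      exists a, (ball x (d / (2 * L + 1)) `&` ball p.1 r) (rad_phi S a) /\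
        ~ [set a | ~ mu.-negligible (xsection (prod_phi @^-1` N) a)] a.
    apply: (rad_dense (x := x) (negligible_xsection N0)).
      by apply: openI; exact: ball_open.
    by split => //; apply: ballxx; rewrite divr_gt0.
  rewrite xsectionE in Na.
  have := lipschitz_ae_slope_le (lipschitz_with_snd (rad_phi S a) gL) st e0 Na.
  have slope' u : s < u < t -> ~ (pair a @^-1` (prod_phi @^-1` N)) u ->
      slope_le (fun t => g (rad_phi S a, t)) e u.
    move=> /andP[su ut] Nu; apply: slope_le_snd; apply: slope => //; split => //.
    move: ps pt; rewrite /ball/= !ltr_distlC => /andP[p1 _] /andP[_ p2].
    by rewrite (lt_trans p1 su) (lt_trans ut p2).
  move=> /(_ slope') Hst.
  rewrite (_ : g (x, s) - g (x, t) = (g (x, s) - g (rad_phi S a, s)) +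
    (g (rad_phi S a, s) - g (rad_phi S a, t)) +
    (g (rad_phi S a, t) - g (x, t))); last by ring.
  have dL : L * `|x - rad_phi S a| <= d / 2.
    rewrite (@le_trans _ _ (L * (d / (2 * L + 1))))//.
      by rewrite ler_wpM2l// ltW//; move: xa; rewrite -ball_normE.
    rewrite mulrA ler_pdivrMr// -subr_ge0.
    rewrite (_ : _ - _ = d / 2); last by field.
    by rewrite divr_ge0// ltW.
  have h1 := lipschitz_with_fst s gL x (rad_phi S a).
  have h2 := lipschitz_with_fst t gL x (rad_phi S a).
  apply: (le_trans (ler_normD _ _)); apply: (le_trans (lerD (ler_normD _ _) (lexx _))).
  rewrite [X in _ + X <= _]distrC.
  rewrite [X in _ + X + _ <= _]distrC.
  rewrite [`|s - t|]distrC (ger0_norm (x := t - s)) ?subr_ge0//.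
  lra.
move=> [y s] [z t] [/= py ps] [/= pz pt].
(* The corner [(z, s)] stays in the ball because balls of the max norm are products. *)
rewrite (_ : g (y, s) - g (z, t) = (g (y, s) - g (z, s)) + (g (z, s) - g (z, t)));
  last by ring.
rewrite (le_trans (ler_normD _ _))//.
have := H1 y z s py pz ps; have := H2 z s t pz ps pt.
rewrite subpE prod_normE/=.
set M := Num.max _ _.
have my : `|y - z| <= M by rewrite le_max lexx.
have ms : `|s - t| <= M by rewrite le_max lexx orbT.
move=> h1 h2; rewrite -mulrA mulrDl mul1r lerD//.
  by rewrite (le_trans h2)// -mulrA ler_wpM2l// ler_wpM2l.
by rewrite (le_trans h1)// ler_wpM2l.
Qed.

Definition rademacher_prod : rademacher_space (V * R)%type.
Proof.
have C1 : 0 <= rad_C S + 1 by rewrite addr_ge0// rad_C_ge0.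
exact: (@RademacherSpace R (V * R)%type _ T
  (product_sigma_finite_measure (rad_mu S) (@lebesgue_measure R)) prod_phi
  prod_B prod_q (rad_C S + 1)
  prod_B_open prod_B_basis prod_B_measurable prod_q_linear prod_q_bounded
  prod_open prod_diff C1 prod_mean_value).
Qed.

End RademacherProduct.

(** * Differentiability in finite dimension *)

Section ApproxDiff.
Context {R : realType} {V W : normedModType R}.
Implicit Types (f : V -> W) (x : V).

Lemma differentiable_approx f x e : differentiable f x -> 0 < e ->
  approx_at f x ('d f x) e.
Proof.
move=> /diff_locally/eqaddoP/(_ e) H /H; apply: filterS => u /=.
by rewrite !fctE/= opprD addrA [u + x]addrC.
Qed.

Lemma approx_differentiable f x (l : {linear V -> W}) : continuous l ->
  (forall e, 0 < e -> approx_at f x l e) ->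
  differentiable f x /\ 'd f x = l :> (V -> W).
Proof.
move=> cl H.
have E : f \o shift x = cst (f x) + (l : V -> W) +o_ 0 id.
  apply/eqaddoP => e /H; apply: filterS => u /=.
  by rewrite !fctE/= opprD addrA [u + x]addrC.
have dE := diff_unique cl E; split => //.
by apply/diff_locallyP; rewrite dE; split.
Qed.

End ApproxDiff.

Section Linear.
Context {R : realType}.

Definition pack_linear (V W : normedModType R) (l : V -> W) (ll : linear l) :
  {linear V -> W} := HB.pack l (GRing.isLinear.Build R V W *:%R l ll).

Lemma bounded_continuous (V W : normedModType R) (l : V -> W) k : linear l ->
  (forall u, `|l u| <= k * `|u|) -> continuous l.
Proof.
move=> ll lk; apply: (@lipschitz_with_continuous R V W k) => x y.
have -> : l x - l y = l (x - y).
  exact: (esym (linearB (pack_linear ll) x y)).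
exact: lk.
Qed.

End Linear.

(** * Coordinates and compactness in finite dimension *)

Section FiniteDim.
Context {R : realType} {X : finHilbertType R}.
Local Notation n := (\dim {:X}).

Definition basis_vec (i : 'I_n) : X := (vbasis {:X})`_i.
Definition vcoord (i : 'I_n) (x : X) : R := coord (vbasis {:X}) i x.

Lemma vcoord_sum (x : X) : x = \sum_i vcoord i x *: basis_vec i.
Proof. exact/coord_vbasis/memvf. Qed.

Lemma vcoord_linear i : linear (vcoord i : X -> R).
Proof. by move=> a x y; rewrite /vcoord linearP. Qed.

Let lc (c : 'rV[R]_n) : X := \sum_i c 0 i *: basis_vec i.

Let lc_linear : linear lc.
Proof.
move=> a x y; rewrite /lc scaler_sumr -big_split/=; apply: eq_bigr => i _.
by rewrite !mxE scalerDl scalerA.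
Qed.

Let lc_inj c : lc c = 0 -> c = 0.
Proof.
move=> H; apply/rowP => i; rewrite mxE.
have /freeP : free (vbasis {:X}) by exact: (basis_free (vbasisP _)).
by move=> /(_ (c 0) H i).
Qed.

Let lc_coord x : lc (\row_i vcoord i x) = x.
Proof. by rewrite [RHS]vcoord_sum; apply: eq_bigr => i _; rewrite mxE. Qed.

Let lc_bounded c : `|lc c| <= (\sum_i `|basis_vec i|) * `|c|.
Proof.
rewrite (le_trans (ler_norm_sum _ _ _))// mulr_suml ler_sum// => i _.
rewrite normrZ mulrC ler_wpM2l//.
rewrite [leRHS]/Num.norm/= mx_normrE.
exact: (le_bigmax _ (fun ij : 'I_1 * 'I_n => `|c ij.1 ij.2|) (0, i)).
Qed.

Let lc_continuous : continuous lc.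
Proof. exact: bounded_continuous lc_linear lc_bounded. Qed.

(** On the compact unit sphere the norm of [lc c] is continuous and, the basis being free, never 0,
    hence at least some [d > 0]; homogeneity does the rest. *)
Let lc_coercive : exists2 k, 0 < k & forall c, `|c| <= k * `|lc c|.
Proof.
pose K := [set c : 'rV[R]_n | `|c| = 1].
have cK : compact K.
  apply: bounded_closed_compact.
    by exists 1; split => // x x1 c /= ->; exact: ltW.
  rewrite (_ : K = (fun c => `|c|) @^-1` [set 1])//.
  apply: closed_comp => [c _|]; first exact: norm_continuous.
  exact: closed_eq.
have cI : compact ((fun c => `|lc c|) @` K).
  apply: continuous_compact => //; apply: continuous_subspaceT => c.
  by apply: (continuous_comp (@lc_continuous c)); exact: norm_continuous.
have cc := compact_closed (@Rhausdorff R) cI.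
have nI : (~` ((fun c => `|lc c|) @` K)) 0.
  move=> [c /= c1 /eqP]; rewrite normr_eq0 => /eqP /lc_inj c0.
  by move: c1; rewrite /K/= c0 normr0 => /eqP; rewrite eq_sym oner_eq0.
have /nbhs_ballP[d /= d0 dI] := open_nbhs_nbhs (conj (closed_openC cc) nI).
have H c : `|c| = 1 -> d <= `|lc c|.
  move=> c1; rewrite leNgt; apply/negP => cd.
  apply: (dI `|lc c|); last by exists c.
  by rewrite /ball/= sub0r normrN normr_id.
exists d^-1; first by rewrite invr_gt0.
move=> c; have [->|c0] := eqVneq c 0; first by rewrite normr0 mulr_ge0// invr_ge0 ltW.
have nc0 : 0 < `|c| by rewrite normr_gt0.
have := H (`|c|^-1 *: c).
rewrite normrZ gtr0_norm ?invr_gt0// mulVf ?gt_eqF// => /(_ erefl).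
have := lc_linear `|c|^-1 c 0; rewrite addr0 => ->.
rewrite (_ : lc 0 = 0) ?addr0; last first.
  by rewrite /lc big1// => i _; rewrite mxE scale0r.
rewrite normrZ gtr0_norm ?invr_gt0// mulrC ler_pdivlMr// => h.
by rewrite ler_pdivlMl.
Qed.

Lemma vcoord_bounded : exists2 k, 0 < k & forall i x, `|vcoord i x| <= k * `|x|.
Proof.
have [k k0 H] := lc_coercive; exists k => // i x.
have := H (\row_i vcoord i x); rewrite lc_coord; apply: le_trans.
rewrite [leRHS]/Num.norm/= mx_normrE.
have := le_bigmax 0 (fun ij : 'I_1 * 'I_n =>
  `|(\row_i vcoord i x : 'rV_n) ij.1 ij.2|) (0, i).
by rewrite /= mxE.
Qed.

Lemma finite_linear_bounded (W : normedModType R) (l : X -> W) : linear l ->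
  exists2 k, 0 <= k & forall x, `|l x| <= k * `|x|.
Proof.
move=> ll; have [k k0 H] := vcoord_bounded.
pose L := pack_linear ll.
exists (k * \sum_i `|l (basis_vec i)|); first by rewrite mulr_ge0 ?sumr_ge0 ?ltW.
move=> x; rewrite -[l x]/(L x) [in leLHS](vcoord_sum x) linear_sum.
rewrite (le_trans (ler_norm_sum _ _ _))// mulr_sumr mulr_suml ler_sum// => i _.
by rewrite linearZ/= normrZ mulrAC ler_wpM2r.
Qed.

Lemma finite_linear_continuous (W : normedModType R) (l : X -> W) : linear l ->
  continuous l.
Proof.
by move=> ll; have [k _] := finite_linear_bounded ll; exact: bounded_continuous.
Qed.

Lemma compact_closed_ball0 (r : R) : compact [set x : X | `|x| <= r].
Proof.
have [k k0 H] := lc_coercive.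
pose K := [set c : 'rV[R]_n | `|lc c| <= r].
have -> : [set x : X | `|x| <= r] = lc @` K.
  apply/seteqP; split => [x xr|_ [c cr <-]//].
  by exists (\row_i vcoord i x); rewrite ?/K/= lc_coord.
apply: continuous_compact; first exact: continuous_subspaceT.
apply: bounded_closed_compact.
  exists (k * r); split; first exact: num_real.
  move=> x krx c /= cr; rewrite (le_trans (H _))// ltW// (le_lt_trans _ krx)//.
  by rewrite ler_wpM2l// ltW.
rewrite (_ : K = (fun c => `|lc c|) @^-1` [set x | x <= r])//.
apply: closed_comp => [c _|]; last exact: closed_le.
by apply: (continuous_comp (@lc_continuous c)); exact: norm_continuous.
Qed.

(** Substitute for extracting a convergent subsequence: a cluster point of the values, phrased so
    that any property eventually true along [F] can be imposed at the same time. *)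
Lemma bounded_cluster (T : Type) (F : set_system T) {FF : ProperFilter F}
    (f : T -> X) r : (\forall t \near F, `|f t| <= r) ->
  exists2 v, `|v| <= r &
    forall P, F P -> forall e, 0 < e -> exists2 t, P t & `|f t - v| < e.
Proof.
move=> Fr; have [v [vr cv]] := compact_closed_ball0 (fmap_proper_filter f FF) Fr.
exists v => // P FP e e0.
have FA : (f @ F) (f @` P) by apply: (filterS (F := F) _ FP) => t Pt; exists t.
have [_ [[t Pt <-] vt]] := cv _ _ FA (nbhsx_ballx v e e0).
by exists t => //; move: vt; rewrite -ball_normE/= distrC.
Qed.

End FiniteDim.

(** * Lipschitz maps between Hilbert spaces *)

(** The model space carries a max norm and is in general not isometric to [Y]; bounded linear maps
    [p] and [s] with [p \o s] the identity suffice to transport the estimates. *)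
Lemma rademacher_cover (R : realType) (Y : finHilbertType R) :
  exists (V : normedModType R) (S : rademacher_space V) (p : V -> Y)
    (s : Y -> V) (kp ks : R),
  [/\ linear p, linear s, 0 < kp /\ forall v, `|p v| <= kp * `|v|,
      0 < ks /\ forall y, `|s y| <= ks * `|y| & cancel s p].
Proof.
(* Induction on the number [k] of coordinates already reproduced: [p (s y)] is the truncation of [y]
   to the first [k] basis vectors. *)
suff H k : (k <= \dim {:Y})%N ->
  exists (V : normedModType R) (S : rademacher_space V) (p : V -> Y)
    (s : Y -> V) (kp ks : R),
  [/\ linear p, linear s, 0 < kp /\ forall v, `|p v| <= kp * `|v|,
      0 < ks /\ forall y, `|s y| <= ks * `|y| &
      forall y, p (s y) = \sum_(i < \dim {:Y} | (i < k)%N)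
        vcoord i y *: basis_vec i].
  have [V [S [p [s [kp [ks [lp ls bp bs ps]]]]]]] := H _ (leqnn _).
  exists V, S, p, s, kp, ks; split => // y; rewrite ps [RHS]vcoord_sum.
  by apply: eq_bigl => i; rewrite ltn_ord.
elim: k => [_|k IH kn].
  exists 'rV[R]_0, (rademacher_trivial (V := 'rV[R]_0) (fun x => thinmx0 x)).
  exists (fun=> 0), (fun=> 0), 1, 1; split.
  - by move=> a u v; rewrite scaler0 addr0.
  - by move=> a u v; rewrite scaler0 addr0.
  - by split => // v; rewrite normr0 mul1r.
  - by split => // v; rewrite normr0 mul1r.
  - by move=> y; rewrite big1.
have [V [S [p [s [kp [ks [lp ls [kp0 bp] [ks0 bs] ps]]]]]]] := IH (ltnW kn).
pose i0 : 'I_(\dim {:Y}) := Ordinal kn.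
have [kc kc0 bc] := @vcoord_bounded R Y.
exists (V * R)%type, (rademacher_prod S).
exists (fun v => p v.1 + v.2 *: basis_vec i0), (fun y => (s y, vcoord i0 y)).
exists (kp + `|basis_vec i0|), (ks + kc); split.
- move=> a u v /=; rewrite lp scalerDl scalerDr scalerA -!addrA; congr (_ + _).
  by rewrite addrCA.
- by move=> a u v /=; rewrite ls vcoord_linear.
- split; first by rewrite ltr_pwDl.
  move=> v; rewrite (le_trans (ler_normD _ _))// mulrDl lerD//.
    rewrite (le_trans (bp _))// ler_wpM2l ?(ltW kp0)//.
    by rewrite prod_normE le_max lexx.
  by rewrite normrZ mulrC ler_wpM2l// prod_normE le_max lexx orbT.
- split; first by rewrite addr_gt0.
  move=> y; rewrite prod_normE/= ge_max mulrDl.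
  rewrite (le_trans (bs _)) ?lerDl ?mulr_ge0 ?(ltW kc0)//=.
  by rewrite (le_trans (bc _ _))// lerDr mulr_ge0// ltW.
- move=> y /=; rewrite ps [RHS](bigD1 i0)//= addrC; congr (_ + _).
  apply: eq_bigl => i; rewrite ltnS -val_eqE/= [RHS]andbC.
  by rewrite [RHS](_ : _ = (i < k)%N)// ltn_neqAle.
Qed.

(** The infimum over [D] of the cones [f y + L * |x - y|] keeps the constant [L]. An extension is
    called for because the results on the model space concern functions that are Lipschitz
    everywhere. *)
Lemma mcshane (R : realType) (V : normedModType R) (D : set V) (f : V -> R)
    (L : R) (x0 : V) : D x0 -> 0 <= L ->
  (forall x y, D x -> D y -> `|f x - f y| <= L * `|x - y|) ->
  exists2 g : V -> R, lipschitz_with L g & forall x, D x -> g x = f x.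
Proof.
move=> Dx0 L0 fL.
pose E x := [set f y + L * `|x - y| | y in D].
have lb x : lbound (E x) (f x0 - L * `|x - x0|).
  move=> _ [y Dy <-]; have := fL _ _ Dx0 Dy; rewrite ler_norml => /andP[_].
  have h : L * `|x0 - y| <= L * `|x - x0| + L * `|x - y|.
    rewrite -mulrDr ler_wpM2l// (_ : x0 - y = (x0 - x) + (x - y)).
      by rewrite [`|x - x0|]distrC ler_normD.
    by rewrite addrA subrK.
  lra.
have En x : E x !=set0 by exists (f x0 + L * `|x - x0|); exists x0.
have infE x y : D y -> inf (E x) <= f y + L * `|x - y|.
  by move=> Dy; apply: ge_inf; [exists (f x0 - L * `|x - x0|)|exists y].
exists (fun x => inf (E x)).
  have H x y : inf (E x) - inf (E y) <= L * `|x - y|.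
    rewrite lerBlDr -lerBlDl; apply: lb_le_inf => // _ [z Dz <-].
    rewrite lerBlDr (le_trans (infE x z Dz))// -addrA lerD2l -mulrDr.
    rewrite ler_wpM2l// (_ : x - z = (y - z) + (x - y)) ?ler_normD//.
    by rewrite [RHS]addrC subrKA.
  move=> x y; rewrite ler_norml H andbT lerNl opprB.
  by rewrite distrC.
move=> x Dx; apply/eqP; rewrite eq_le; apply/andP; split.
  by rewrite (le_trans (infE _ _ Dx))// subrr normr0 mulr0 addr0.
apply: lb_le_inf => // _ [y Dy <-].
by have := fL _ _ Dx Dy; rewrite ler_norml => /andP[_]; rewrite lerBlDl.
Qed.

Lemma near0_homogeneous (R : realType) (V : normedModType R) (a b : V -> R) :
  (forall c u, 0 < c -> a (c *: u) = c * a u) ->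
  (forall c u, 0 < c -> b (c *: u) = c * b u) ->
  (\forall u \near (0 : V), a u <= b u) -> forall u, a u <= b u.
Proof.
move=> ha hb /near0P[n H] u.
pose c := n.+1%:R^-1 / (1 + `|u|).
have c0 : 0 < c by rewrite divr_gt0 ?invr_gt0// ltr_pwDl.
have := H (c *: u); rewrite ha// hb// ler_pM2l//; apply.
rewrite normrZ gtr0_norm// /c -mulrA ler_piMr ?invr_ge0//.
by rewrite mulrC ler_pdivrMr ?mul1r ?ltr_pwDl// lerDr.
Qed.

(* The supremum of [l k u - |u| / (k+1)] plays the role of the limit of the
   approximate derivatives. *)
Lemma approx_lim_differentiable (R : realType) (Y : finHilbertType R)
    (g : Y -> R) (x : Y) :
  (forall e, 0 < e -> exists2 l : Y -> R, linear l & approx_at g x l e) ->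
  differentiable g x.
Proof.
move=> H.
have [eps e0 epsE] : exists2 eps : nat -> R, (forall k, 0 < eps k) &
    forall e, 0 < e -> exists k, eps k <= e.
  exists (fun k => k.+1%:R^-1) => [k|e]; last exact: inv_succ_le.
  by rewrite invr_gt0.
have /choice[l Hl] k : exists l : Y -> R,
    linear l /\ approx_at g x l (eps k).
  by have [l ll Hl] := H _ (e0 k); exists l.
have lE k c u v : l k (c *: u + v) = c * l k u + l k v by rewrite (Hl k).1.
have l0 k : l k 0 = 0.
  exact: (linear0 (pack_linear (Hl k).1)).
have lZ k c u : l k (c *: u) = c * l k u.
  by have := lE k c u 0; rewrite !addr0 l0 addr0.
(* Two approximations are close near 0, hence everywhere by homogeneity; this bounds [E u] above and
   places [L u] within [eps k * |u|] of [l k u]. *)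
have kj k j u : l k u - l j u <= (eps k + eps j) * `|u|.
  move: u; apply: near0_homogeneous => [c u c0|c u c0|].
  - by rewrite !lZ mulrBr.
  - by rewrite normrZ gtr0_norm// mulrCA.
  apply: filterS2 (Hl k).2 (Hl j).2 => u hk hj.
  rewrite (_ : _ - _ = (g (x + u) - g x - l j u) - (g (x + u) - g x - l k u)).
    by rewrite (le_trans (ler_norm _))// (le_trans (ler_normB _ _))// addrC mulrDl lerD.
  by ring.
pose E u := [set l k u - eps k * `|u| | k in [set: nat]].
pose L u := sup (E u).
have Lk k u : `|L u - l k u| <= eps k * `|u|.
  have ubE : ubound (E u) (l k u + eps k * `|u|).
    by move=> _ [j _ <-]; have := kj j k u; rewrite mulrDl; lra.
  have h1 : L u <= l k u + eps k * `|u|.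
    by apply: ge_sup => //; exists (l 0%N u - eps 0%N * `|u|); exists 0%N.
  have h2 : l k u - eps k * `|u| <= L u.
    by apply: ub_le_sup; [exists (l k u + eps k * `|u|)|exists k].
  by rewrite ler_norml; lra.
have LL : linear (L : Y -> R).
  move=> c u v; apply/eqP; rewrite -subr_eq0 -normr_le0; apply/ler_addgt0Pr => e e1.
  rewrite add0r.
  pose M := `|c *: u + v| + `|c| * `|u| + `|v| + 1.
  have M0 : 0 < M by rewrite ltr_wpDl// !addr_ge0// mulr_ge0.
  have [k ke] := epsE _ (divr_gt0 e1 M0).
  rewrite ler_pdivlMr// in ke.
  rewrite (_ : _ - _ = (L (c *: u + v) - l k (c *: u + v)) -
    c * (L u - l k u) - (L v - l k v)); last by rewrite lE /GRing.scale/=; ring.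
  rewrite (le_trans (ler_normB _ _))// (le_trans (lerD (ler_normB _ _) (lexx _)))//.
  rewrite normrM (le_trans _ ke)//.
  have h := ler_wpM2l (normr_ge0 c) (Lk k u).
  have := Lk k (c *: u + v); have := Lk k v; have := ltW (e0 k).
  rewrite /M !mulrDr mulrCA in h *; lra.
have cL := finite_linear_continuous LL.
apply: (approx_differentiable (l := pack_linear LL) cL _).1 => e e1.
have e2 : 0 < e / 2 by rewrite divr_gt0.
have [k ke] := epsE _ e2.
apply: filterS (Hl k).2 => u hu /=.
rewrite (_ : _ - _ = (g (x + u) - g x - l k u) - (L u - l k u)); last by ring.
rewrite (le_trans (ler_normB _ _))// (le_trans (lerD hu (Lk k u)))//.
by rewrite -mulrDl ler_wpM2r//; lra.
Qed.

Lemma differentiable_vcoord (R : realType) (Y : normedModType R)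
    (Z : finHilbertType R) (f : Y -> Z) y :
  (forall j, differentiable (fun y => vcoord j (f y)) y) -> differentiable f y.
Proof.
move=> H.
have -> : f = \sum_(j < \dim {:Z}) (fun y => vcoord j (f y) *: basis_vec j).
  by apply/funext => z; rewrite fct_sumE [LHS]vcoord_sum.
by apply: differentiable_sum => j; exact: differentiableZl.
Qed.

Section LipschitzMaps.
Context {R : realType} {Y Z : finHilbertType R}.
Variables (f : Y -> Z) (U : set Y) (L : R) (y0 : Y).
Hypotheses (oU : open U) (Uy0 : U y0) (L0 : 0 <= L).
Hypothesis fL : forall x y, U x -> U y -> `|f x - f y| <= L * `|x - y|.

(** Each coordinate of [f \o p] is extended from the preimage of [U] to the whole model space. Off
    [N], approximations of [g j] composed with [s] approximate the coordinates of [f] at [p v],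
    since [p (v + s u) = p v + u]. *)
Lemma lipschitz_model : exists (V : normedModType R) (S : rademacher_space V)
  (p : V -> Y) (s : Y -> V) (kp ks Lg : R) (g : 'I_(\dim {:Z}) -> V -> R)
  (N : set V),
  [/\ [/\ linear p, linear s & cancel s p],
      [/\ 0 < kp, 0 < ks, forall v, `|p v| <= kp * `|v| &
         forall y, `|s y| <= ks * `|y|],
      (forall j, lipschitz_with Lg (g j)) /\
        forall j v, U (p v) -> g j v = vcoord j (f (p v)),
      (rad_mu S).-negligible (rad_phi S @^-1` N) &
      forall v, ~ N v -> U (p v) -> differentiable f (p v)].
Proof.
have [V [S [p [s [kp [ks [lp ls [kp0 bp] [ks0 bs] ps]]]]]]] := rademacher_cover Y.
have [kz kz0 bz] := @vcoord_bounded R Z.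
have pB u v : p u - p v = p (u - v).
  exact: (esym (linearB (pack_linear lp) u v)).
have pD u v : p u + p v = p (u + v).
  exact: (esym (linearD (pack_linear lp) u v)).
have vB j (u v : Z) : vcoord j u - vcoord j v = vcoord j (u - v).
  exact: (esym (linearB (pack_linear (@vcoord_linear R Z j)) u v)).
have /choice[g Hg] j : exists g : V -> R, lipschitz_with (kz * (L * kp)) g /\
    forall v, U (p v) -> g v = vcoord j (f (p v)).
  have [|||g gL gE] := @mcshane R V (p @^-1` U) (fun v => vcoord j (f (p v)))
      (kz * (L * kp)) (s y0).
  - by rewrite /preimage/= ps.
  - by rewrite !mulr_ge0// ltW.
  - move=> u v Uu Uv; rewrite vB (le_trans (bz _ _))// -mulrA ler_wpM2l ?(ltW kz0)//.
    by rewrite (le_trans (fL Uu Uv))// -mulrA ler_wpM2l// pB.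
  - by exists g.
pose N := \bigcup_(j : 'I_(\dim {:Z}))
  [set v | ~ forall e, 0 < e -> exists i, approx_at (g j) v (rad_q S i) e].
exists V, S, p, s, kp, ks, (kz * (L * kp)), g, N; split => //.
- by split=> [j|j v]; have [] := Hg j => // _; exact.
- have := @negligible_bigcup_countType _ _ _ (rad_mu S) _ (fun j =>
    rad_phi S @^-1` [set v | ~ forall e, 0 < e ->
      exists i, approx_at (g j) v (rad_q S i) e]).
  by rewrite -preimage_bigcup; apply => j; exact: rad_diff (Hg j).1.
move=> v Nv Uv; apply: differentiable_vcoord => j.
apply: approx_lim_differentiable => e e0.
(* Composition with [s] multiplies the tolerance by at most [ks]. *)
have e1 : 0 < e / ks by rewrite divr_gt0.
have [i Hi] : exists i, approx_at (g j) v (rad_q S i) (e / ks).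
  by apply: contrapT => H; apply: Nv; exists j => //= /(_ _ e1).
exists (rad_q S i \o s); first by move=> a u w /=; rewrite ls rad_q_linear.
have /near0P[n Hn] := Hi.
have cs : continuous s by exact: bounded_continuous ls bs.
have s0 : s 0 = 0 by exact: (linear0 (pack_linear ls)).
have Hs : \forall u \near (0 : Y), `|s u| <= n.+1%:R^-1.
  apply/near0P; have nks : 0 < n.+1%:R^-1 / ks by rewrite divr_gt0// invr_gt0.
  have [m Hm] := inv_succ_le nks; exists m => u um.
  rewrite (le_trans (bs _))// mulrC -ler_pdivlMr// (le_trans um)//.
have HU : \forall u \near (0 : Y), U (p v + u).
  have : nbhs (p v + 0) U by rewrite addr0; exact: open_nbhs_nbhs.
  apply: cvgD; [exact: cvg_cst|exact: cvg_id].
near=> u; rewrite /=.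
have Up : U (p v + u) by near: u.
have Up' : U (p (v + s u)) by rewrite -pD ps.
have su : `|s u| <= n.+1%:R^-1 by near: u.
have := Hn _ su; rewrite (Hg j).2// (Hg j).2// -pD ps => /le_trans; apply.
by rewrite mulrAC ler_pdivrMr// -mulrA ler_wpM2l ?(ltW e0)// mulrC.
Unshelve. all: by end_near. Qed.

Lemma lipschitz_diff_dense (O : set Y) : nbhs y0 O ->
  exists y, [/\ O y, U y & differentiable f y].
Proof.
move=> nO.
have [V [S [p [s [kp [ks [Lg [g [N [[lp ls ps] [kp0 ks0 bp bs] _ N0 Nf]]]]]]]]]] :=
  lipschitz_model.
have cp := bounded_continuous lp bp.
pose O' := p @^-1` (O^° `&` U).
have oO' : open O'.
  by apply: open_comp; [move=> v _; exact: cp|apply: openI => //; exact: open_interior].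
have Os : O' (s y0) by rewrite /O'/preimage/= ps; split.
have [a [[Oa Ua] Na]] := rad_dense N0 oO' Os.
exists (p (rad_phi S a)); split => //; last exact: Nf.
exact: interior_subset Oa.
Qed.

(** Near [s y0] and off [N], each coordinate of [(f - A) \o p] has local slope at most [K * e1], so
    the mean value inequality of the model space applies between [s y] and [s y']. *)
Lemma lipschitz_strict (A : Y -> Z) : linear A ->
  (forall e, 0 < e -> \forall y \near y0, differentiable f y ->
     forall u, `|'d f y u - A u| <= e * `|u|) ->
  forall e, 0 < e -> exists2 d, 0 < d & forall y y', `|y - y0| < d ->
    `|y' - y0| < d -> `|f y - f y' - A (y - y')| <= e * `|y - y'|.
Proof.
move=> lA dA e e0.
have [V [S [p [s [kp [ks [Lg [g [N [[lp ls ps] [kp0 ks0 bp bs] [gL gE] N0 Nf]]]]]]]]]] :=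
  lipschitz_model.
have [kz kz0 bz] := @vcoord_bounded R Z.
have [ka ka0 bA] := finite_linear_bounded lA.
have pB u v : p u - p v = p (u - v).
  exact: (esym (linearB (pack_linear lp) u v)).
have pD u v : p u + p v = p (u + v).
  exact: (esym (linearD (pack_linear lp) u v)).
have sB u v : s u - s v = s (u - v).
  exact: (esym (linearB (pack_linear ls) u v)).
have AB u v : A u - A v = A (u - v).
  exact: (esym (linearB (pack_linear lA) u v)).
have vB j (u v : Z) : vcoord j u - vcoord j v = vcoord j (u - v).
  exact: (esym (linearB (pack_linear (@vcoord_linear R Z j)) u v)).
pose K := kz * kp.
have K0 : 0 < K by rewrite mulr_gt0.
pose B := \sum_(j < \dim {:Z}) `|basis_vec j : Z|.
have B0 : 0 <= B by rewrite sumr_ge0.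
(* Losses to absorb: [K] from a coordinate and [p], [rad_C S] from the mean value inequality, [ks]
   from [s], and [B] from summing the coordinates. *)
pose e1 := e / (K * rad_C S * ks * B + 1).
have D0 : 0 < K * rad_C S * ks * B + 1.
  by rewrite ltr_wpDl// !mulr_ge0 ?rad_C_ge0// ltW.
have e10 : 0 < e1 by rewrite divr_gt0.
pose h j v := g j v - vcoord j (A (p v)).
have hL j : lipschitz_with (Lg + kz * (ka * kp)) (h j).
  move=> u v; rewrite /h.
  rewrite (_ : _ - _ = (g j u - g j v) -
    (vcoord j (A (p u)) - vcoord j (A (p v)))); last by ring.
  rewrite (le_trans (ler_normB _ _))// mulrDl lerD ?gL//.
  rewrite vB AB pB (le_trans (bz _ _))// -!mulrA ler_wpM2l ?(ltW kz0)//.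
  by rewrite (le_trans (bA _))// ler_wpM2l.
have cp := bounded_continuous lp bp.
have : \forall v \near s y0, U (p v) /\ (differentiable f (p v) ->
     forall u, `|'d f (p v) u - A u| <= e1 * `|u|).
  have H : \forall y \near p (s y0), U y /\ (differentiable f y ->
      forall u, `|'d f y u - A u| <= e1 * `|u|).
    rewrite ps; apply: filterS2 (dA _ e10) (open_nbhs_nbhs (conj oU Uy0)) => y.
    by split.
  exact: (cp _ _ H).
move=> /nbhs_ballP[r /= r0 Hr].
have slope j v : ball (s y0) r v -> ~ N v -> slope_le (h j) (K * e1) v.
  move=> vr Nv eta eta0.
  have [Uv /(_ (Nf _ Nv Uv)) dv] := Hr _ vr.
  have etaK : 0 < eta / K by rewrite divr_gt0.
  have /near0P[n Hn] := differentiable_approx (Nf _ Nv Uv) etaK.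
  have Hp : \forall w \near (0 : V), `|p w| <= n.+1%:R^-1.
    apply/near0P; have nkp : 0 < n.+1%:R^-1 / kp by rewrite divr_gt0// invr_gt0.
    have [m Hm] := inv_succ_le nkp; exists m => u um.
    by rewrite (le_trans (bp _))// mulrC -ler_pdivlMr// (le_trans um).
  have HU : \forall w \near (0 : V), U (p (v + w)).
    have : nbhs (p (v + 0)) U by rewrite addr0; exact: open_nbhs_nbhs.
    apply: (cvg_comp (fun w => v + w) p); last exact: cp.
    by apply: cvgD; [exact: cvg_cst|exact: cvg_id].
  near=> w.
  have pw : `|p w| <= n.+1%:R^-1 by near: w.
  have Uvw : U (p (v + w)) by near: w.
  rewrite /h gE// gE// -pD.
  rewrite (_ : _ - _ = vcoord j (f (p v + p w) - f (p v) -
    (A (p v + p w) - A (p v)))); last first.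
    by rewrite -!vB; ring.
  rewrite AB [p v + _]addrC addrK [_ + p v]addrC.
  rewrite (_ : _ - A (p w) = (f (p v + p w) - f (p v) - 'd f (p v) (p w)) +
    ('d f (p v) (p w) - A (p w))); last by rewrite addrA subrK.
  rewrite (le_trans (bz _ _))//.
  have h1 := Hn _ pw; have h2 := dv (p w).
  apply: (@le_trans _ _ (kz * ((eta / K + e1) * (kp * `|w|)))).
    rewrite ler_wpM2l ?(ltW kz0)// (le_trans (ler_normD _ _))//.
    rewrite (le_trans (lerD h1 h2))// -mulrDl ler_wpM2l//.
    by rewrite addr_ge0 ?ltW.
  rewrite le_eqVlt; apply/orP; left; apply/eqP; rewrite /K; field.
  by rewrite !gt_eqF.
exists (r / ks) => [|y y' yr yr']; first by rewrite divr_gt0.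
have sball z : `|z - y0| < r / ks -> ball (s y0) r (s z).
  move=> zr; rewrite -ball_normE/= distrC sB (le_lt_trans (bs _))// mulrC.
  by rewrite -ltr_pdivlMr.
have [Uy Uy'] : U y /\ U y'.
  have [+ _] := Hr _ (sball _ yr); have [+ _] := Hr _ (sball _ yr').
  by rewrite !ps.
have Ke0 : 0 <= K * e1 by rewrite mulr_ge0 ?ltW.
have comp j : `|vcoord j (f y - f y' - A (y - y'))| <=
    K * rad_C S * ks * e1 * `|y - y'|.
  have := rad_mean_value (hL j) Ke0 N0 (slope j) (sball _ yr) (sball _ yr').
  rewrite /h gE ?ps// gE ?ps// sB => H.
  rewrite -AB -!vB (_ : _ - _ = vcoord j (f y) - vcoord j (A y) -
    (vcoord j (f y') - vcoord j (A y'))); last by ring.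
  apply: (le_trans H).
  rewrite (_ : K * rad_C S * ks * e1 * _ =
    rad_C S * (K * e1) * (ks * `|y - y'|)); last by ring.
  by rewrite ler_wpM2l// mulr_ge0// rad_C_ge0.
rewrite [X in `|X|]vcoord_sum (le_trans (ler_norm_sum _ _ _))//.
apply: (@le_trans _ _ (\sum_(j < \dim {:Z})
    (K * rad_C S * ks * e1 * `|y - y'|) * `|basis_vec j : Z|)).
  by apply: ler_sum => j _; rewrite normrZ ler_wpM2r.
rewrite -mulr_sumr -/B mulrAC ler_wpM2r//.
rewrite /e1 mulrAC mulrA ler_pdivrMr// [leRHS]mulrDr mulr1 mulrC lerDl.
exact: ltW.
Unshelve. all: by end_near. Qed.

End LipschitzMaps.

(** * Set limits and tangent cones *)

Section SetLimitTheory.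
Context {R : realType} {T : Type} {X : normedModType R}.
Implicit Types (F : set_system T) (S : T -> set X).

Lemma outer_limitP F S v : outer_limit F S v <->
  forall A, F A -> forall e, 0 < e -> exists t w, [/\ A t, S t w & `|w - v| < e].
Proof.
split=> [H A FA e e0|H A FA B /nbhs_ballP[e /= e0 eB]].
  have [w [[t At Sw] vw]] := H A FA _ (nbhsx_ballx v e e0).
  by exists t, w; split => //; move: vw; rewrite -ball_normE/= distrC.
have [t [w [At Sw wv]]] := H A FA e e0.
exists w; split; first by exists t.
by apply: eB; rewrite -ball_normE/= distrC.
Qed.

Lemma inner_limitP F S v : Filter F -> inner_limit F S v <->
  forall e, 0 < e -> \forall t \near F, exists2 w, S t w & `|w - v| < e.
Proof.
move=> FF; split=> [H e e0|H B /nbhs_ballP[e /= e0 eB]].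
  apply: filterS (H _ (nbhsx_ballx v e e0)) => t [w [Sw vw]].
  by exists w => //; move: vw; rewrite -ball_normE/= distrC.
apply: filterS (H e e0) => t [w Sw wv]; exists w; split => //.
by apply: eB; rewrite -ball_normE/= distrC.
Qed.

Lemma inner_sub_outer F S : ProperFilter F -> inner_limit F S `<=` outer_limit F S.
Proof.
move=> FF v /inner_limitP H; apply/outer_limitP => A FA e e0.
by have [t [At [w Sw wv]]] := filter_ex (filterI FA (H e e0)); exists t, w.
Qed.

(** A finer filter enlarges the inner limit and shrinks the outer one; properness of [F'] keeps the
    first inside the second, so both stay equal to [L]. *)
Lemma set_converges_sub F F' S (L : set X) : Filter F -> ProperFilter F' ->
  F `<=` F' -> set_converges F S L -> set_converges F' S L.
Proof.
move=> FF FF' FF'S [iL oL].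
have h1 : L `<=` inner_limit F' S.
  rewrite -iL => v /inner_limitP H; apply/inner_limitP => e e0.
  exact: FF'S (H e e0).
have h2 : outer_limit F' S `<=` L.
  rewrite -oL => v /outer_limitP H; apply/outer_limitP => A /FF'S.
  exact: H.
have h3 := @inner_sub_outer F' S FF'.
split; apply/seteqP; split => //.
- exact: subset_trans h3 h2.
- exact: subset_trans h1 h3.
Qed.

End SetLimitTheory.

Section Bases.
Context {R : realType}.

Lemma at_right0P (A : set R) :
  0^'+ A <-> exists2 d, 0 < d & forall t, 0 < t < d -> A t.
Proof.
rewrite /at_right /within /=; split=> [/nbhs_ballP[d /= d0 dA]|[d d0 dA]].
  exists d => // t /andP[t0 td]; apply: dA => //.
  by rewrite /ball/= sub0r normrN gtr0_norm.
apply/nbhs_ballP; exists d => //= t; rewrite /ball/= sub0r normrN => td t0.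
by apply: dA; rewrite t0 -(gtr0_norm t0).
Qed.

Lemma withinP_dist (X : normedModType R) (D A : set X) (x : X) :
  within D (nbhs x) A <->
  exists2 d, 0 < d & forall y, `|y - x| < d -> D y -> A y.
Proof.
rewrite /within /=; split=> [/nbhs_ballP[d /= d0 dA]|[d d0 dA]].
  exists d => // y yd Dy; apply: dA => //.
  by rewrite -ball_normE/= distrC.
apply/nbhs_ballP; exists d => //= y; rewrite -ball_normE/= distrC => yd.
exact: dA.
Qed.

Lemma within_proper (X : normedModType R) (D : set X) (x : X) :
  (forall d, 0 < d -> exists2 y, `|y - x| < d & D y) ->
  ProperFilter (within D (nbhs x)).
Proof.
move=> H; split; last exact: within_filter.
by move=> /withinP_dist[d d0 dA]; have [y yd Dy] := H d d0; exact: (dA y).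
Qed.

Lemma base_filterP (X : finHilbertType R) (Omega : set X) x (A : set (X * R)) :
  base_point_filter Omega x A <->
  exists2 d, 0 < d & forall y t, Omega y -> `|y - x| < d -> 0 < t < d -> A (y, t).
Proof.
split=> [[[P Q]/= [/withinP_dist[d1 d10 dP] /at_right0P[d2 d20 dQ]] PQ]|[d d0 dA]].
  exists (Num.min d1 d2); first by rewrite lt_min d10.
  move=> y t Oy; rewrite !lt_min => /andP[y1 _] /and3P[t0 _ t2].
  by apply: (PQ (y, t)); split => /=; [exact: dP|apply: dQ; rewrite t0].
exists (Omega `&` [set y | `|y - x| < d], [set t | 0 < t < d]) => /=.
  split; first by apply/withinP_dist; exists d.
  by apply/at_right0P; exists d.
by move=> [y t] /= [[Oy yd] td]; exact: dA.
Qed.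

End Bases.

Section Cones.
Context {R : realType} {X : finHilbertType R}.
Implicit Types (Omega : set X) (x v : X).

Local Notation quot t y x := (t^-1 *: (y - x)).

Lemma tangent_coneP Omega x v : tangent_cone Omega x v <->
  forall e d, 0 < e -> 0 < d -> exists t y, [/\ 0 < t < d, Omega y &
    `|quot t y x - v| < e].
Proof.
rewrite /tangent_cone outer_limitP; split=> [H e d e0 d0|H A /at_right0P[d d0 dA] e e0].
  have [|t [w [td [y Oy <-] yv]]] := H [set t | 0 < t < d] _ e e0.
    by apply/at_right0P; exists d.
  by exists t, y.
have [t [y [td Oy yv]]] := H e d e0 d0.
by exists t, (quot t y x); split => //; [exact: dA|exists y].
Qed.

Lemma derivable_coneP Omega x v : derivable_cone Omega x v <->
  forall e, 0 < e -> exists2 d, 0 < d & forall t, 0 < t < d ->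
    exists2 y, Omega y & `|quot t y x - v| < e.
Proof.
rewrite /derivable_cone inner_limitP; split=> H e e0.
  have /at_right0P[d d0 dA] := H e e0; exists d => // t /dA[_ [y Oy <-] yv].
  by exists y.
have [d d0 dA] := H e e0; apply/at_right0P; exists d => // t /dA[y Oy yv].
by exists (quot t y x) => //; exists y.
Qed.

Lemma regular_coneP Omega x v : regular_tangent_cone Omega x v <->
  forall e, 0 < e -> exists2 d, 0 < d & forall x' t, Omega x' -> `|x' - x| < d ->
    0 < t < d -> exists2 y, Omega y & `|quot t y x' - v| < e.
Proof.
rewrite /regular_tangent_cone inner_limitP; split=> H e e0.
  have /base_filterP[d d0 dA] := H e e0; exists d => // x' t Ox xd td.
  by have [_ [y Oy <-] yv] := dA x' t Ox xd td; exists y.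
have [d d0 dA] := H e e0; apply/base_filterP; exists d => // x' t Ox xd td.
by have [y Oy yv] := dA x' t Ox xd td; exists (quot t y x') => //; exists y.
Qed.

Lemma paratingent_coneP Omega x v : paratingent_cone Omega x v <->
  forall e d, 0 < e -> 0 < d -> exists x' t y, [/\ Omega x', `|x' - x| < d,
    0 < t < d, Omega y & `|quot t y x' - v| < e].
Proof.
rewrite /paratingent_cone outer_limitP.
split=> [H e d e0 d0|H A /base_filterP[d d0 dA] e e0].
  have [|[x' t] [w [/= [Ox xd td] [y Oy <-] yv]]] :=
      H [set p | [/\ Omega p.1, `|p.1 - x| < d & 0 < p.2 < d]] _ e e0.
    by apply/base_filterP; exists d.
  by exists x', t, y.
have [x' [t [y [Ox xd td Oy yv]]]] := H e d e0 d0.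
by exists (x', t), (quot t y x'); split => //; [exact: dA|exists y].
Qed.

Lemma regular_sub_derivable Omega x : Omega x ->
  regular_tangent_cone Omega x `<=` derivable_cone Omega x.
Proof.
move=> Ox v /regular_coneP H; apply/derivable_coneP => e /H[d d0 Hd].
by exists d => // t td; apply: Hd => //; rewrite subrr normr0.
Qed.

Lemma derivable_sub_tangent Omega x :
  derivable_cone Omega x `<=` tangent_cone Omega x.
Proof. exact: inner_sub_outer. Qed.

Lemma tangent_sub_paratingent Omega x : Omega x ->
  tangent_cone Omega x `<=` paratingent_cone Omega x.
Proof.
move=> Ox v /tangent_coneP H; apply/paratingent_coneP => e d e0 d0.
have [t [y [td Oy yv]]] := H e d e0 d0.
by exists x, t, y; rewrite subrr normr0.
Qed.

(** A tangent vector at [x'] close to [v] is itself nearly a difference quotient with base point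
    [x']. *)
Lemma outer_tangent_sub_paratingent Omega x :
  outer_limit (within Omega (nbhs x)) (tangent_cone Omega) `<=`
  paratingent_cone Omega x.
Proof.
move=> v /outer_limitP H; apply/paratingent_coneP => e d e0 d0.
have e2 : 0 < e / 2 by rewrite divr_gt0.
have [|x' [w [[xd Ox] /tangent_coneP Tw wv]]] :=
    H (Omega `&` [set x' | `|x' - x| < d]) _ _ e2.
  by apply/withinP_dist; exists d.
have [t [y [td Oy yw]]] := Tw _ d e2 d0.
exists x', t, y; split => //.
rewrite (_ : _ - v = (quot t y x' - w) + (w - v)); last by rewrite subrKA.
by rewrite (le_lt_trans (ler_normD _ _))// [ltRHS]splitr ltrD.
Qed.

(** For fixed [x'] near [x] the quotients stay within [e / 2] of [v] as [t] tends to 0; a cluster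
    point of them is a tangent vector at [x'] close to [v]. *)
Lemma regular_sub_inner_tangent Omega x :
  regular_tangent_cone Omega x `<=`
  inner_limit (within Omega (nbhs x)) (tangent_cone Omega).
Proof.
move=> v /regular_coneP H; apply/inner_limitP => e e0.
have e2 : 0 < e / 2 by rewrite divr_gt0.
have [d d0 Hd] := H _ e2; apply/withinP_dist; exists d => // x' xd Ox.
have /choice[y Hy] t : exists y, 0 < t < d ->
    Omega y /\ `|quot t y x' - v| < e / 2.
  case: (pselect (0 < t < d)) => [td|ntd]; last by exists 0.
  by have [y Oy yv] := Hd x' t Ox xd td; exists y.
have [|w wr Hw] :=
  @bounded_cluster R X R 0^'+ _ (fun t => quot t (y t) x') (`|v| + e / 2).
  apply/at_right0P; exists d => // t /Hy[_ yv].
  by rewrite -lerBlDl (le_trans (lerB_dist _ _))// ltW.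
exists w.
  apply/tangent_coneP => e1 d1 e10 d10.
  have [|t /andP[t0]] := Hw [set t | 0 < t < Num.min d d1] _ e1 e10.
    by apply/at_right0P; exists (Num.min d d1) => //; rewrite lt_min d0.
  rewrite lt_min => /andP[td td1] yw; have [|Oy _] := Hy t; first by rewrite t0.
  by exists t, (y t); split => //; rewrite t0.
have [|t /Hy[_ yv] yw] := Hw [set t | 0 < t < d] _ _ e2.
  by apply/at_right0P; exists d.
rewrite (_ : w - v = (quot t (y t) x' - v) - (quot t (y t) x' - w)); last first.
  by rewrite opprB [RHS]addrC subrKA.
by rewrite (le_lt_trans (ler_normB _ _))// [ltRHS]splitr ltrD.
Qed.

(** The four cones are nested, and strict smoothness identifies the smallest with the largest. *)
Lemma strictly_smooth_tangent Omega x : Omega x -> strictly_smooth_at Omega x ->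
  [/\ derivable_cone Omega x = tangent_cone Omega x,
      regular_tangent_cone Omega x = tangent_cone Omega x &
      paratingent_cone Omega x = tangent_cone Omega x].
Proof.
move=> Ox a.
have h1 := regular_sub_derivable Ox.
have h2 := @derivable_sub_tangent Omega x.
have h3 := tangent_sub_paratingent Ox.
rewrite -a in h3; rewrite -a.
have h4 : regular_tangent_cone Omega x = tangent_cone Omega x.
  by apply/seteqP; split => //; exact: subset_trans h1 h2.
split => //; apply/seteqP; split => //.
exact: subset_trans h3 h1.
Qed.

Lemma within_set_proper Omega x : Omega x -> ProperFilter (within Omega (nbhs x)).
Proof.
by move=> Ox; apply: within_proper => d d0; exists x; rewrite ?subrr ?normr0.
Qed.

Lemma strictly_smooth_converges Omega x : Omega x -> strictly_smooth_at Omega x ->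
  set_converges (within Omega (nbhs x)) (tangent_cone Omega) (tangent_cone Omega x).
Proof.
move=> Ox /(strictly_smooth_tangent Ox)[_ hR hP].
have h1 := @regular_sub_inner_tangent Omega x.
have h2 := @outer_tangent_sub_paratingent Omega x.
have h3 := inner_sub_outer (S := tangent_cone Omega) (within_set_proper Ox).
rewrite hR in h1; rewrite hP in h2.
split; apply/seteqP; split => //.
  exact: subset_trans h3 h2.
exact: subset_trans h1 h3.
Qed.

(** A subspace of maximal dimension inside [S] is all of [S]: a vector of [S] outside it would span
    a larger one with it. *)
Lemma vspace_of_set (S : set X) : S 0 ->
  (forall (c : R) u v, S u -> S v -> S (c *: u + v)) ->
  exists V : {vspace X}, S = [set` V].
Proof.
move=> S0 SL.
pose P k := `[< exists2 V : {vspace X}, [set` V] `<=` S & \dim V = k >].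
have P0 : exists k, P k.
  exists 0%N; apply/asboolP; exists 0%VS; last exact: dimv0.
  by move=> x /=; rewrite memv0 => /eqP ->.
have Pb k : P k -> (k <= \dim {:X})%N.
  by move=> /asboolP[V _ <-]; exact/dimvS/subvf.
case: (ex_maxnP P0 Pb) => k /asboolP[V VS Vk] kmax.
exists V; apply/seteqP; split => // x Sx /=; apply: contrapT => /negP xV.
have : P (\dim (<[x]> + V)%VS).
  apply/asboolP; exists (<[x]> + V)%VS => // z /= /memv_addP[u /vlineP[c ->]].
  by move=> [w wV ->]; apply: SL => //; exact: VS.
move=> /kmax; rewrite leqNgt -Vk => /negP; apply.
rewrite ltnNge; apply/negP => H.
have /eqP VE : V == (<[x]> + V)%VS by rewrite eqEdim addvSr.
by move: xV; rewrite VE (subvP (addvSl _ _)) ?memv_line.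
Qed.

End Cones.

Lemma finite_lower_bound (R : realType) n (d : 'I_n -> R) :
  (forall j, 0 < d j) -> exists2 d0, 0 < d0 & forall j, d0 <= d j.
Proof.
move=> d0; exists (\big[Num.min/1]_j d j) => [|j]; last exact: bigmin_le.
by apply: lt_bigmin.
Qed.

(** * Strict differentiability of C1 maps *)

Section StrictDerivative.
Context {R : realType}.

Lemma ball_segment (V : normedModType R) (p q q' : V) (d t : R) :
  0 <= t <= 1 -> ball p d q -> ball p d q' -> ball p d (q' + t *: (q - q')).
Proof.
move=> /andP[t0 t1]; rewrite -!ball_normE/= => qd qd'.
have -> : p - (q' + t *: (q - q')) = t *: (p - q) + (1 - t) *: (p - q').
  rewrite scalerBl scale1r addrCA -scalerBr (opprB p q') [p - q + _]addrC subrKA.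
  by rewrite -[q' - q]opprB scalerN -addrA -opprD.
rewrite (le_lt_trans (ler_normD _ _))// !normrZ (ger0_norm t0).
rewrite ger0_norm ?subr_ge0//.
have [->|tn0] := eqVneq t 0; first by rewrite subr0 mul0r mul1r add0r.
have h1 : t * `|p - q| < t * d by rewrite ltr_pM2l// lt_neqAle eq_sym tn0.
have h2 : (1 - t) * `|p - q'| <= (1 - t) * d.
  by rewrite ler_wpM2l ?subr_ge0// ltW.
by rewrite (lt_le_trans (ltr_leD h1 h2))// -mulrDl addrC subrK mul1r.
Qed.

(** The mean value theorem on the segment from [q'] to [q] needs a real-valued function, hence the
    form [l]; along the segment the derivative of [f] is within [e / k] of ['d f p] in operator
    norm. *)
Lemma C1_strict_scalar (V W : normedModType R) (O : set V) (f : V -> W)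
    (l : W -> R) k p : linear l -> 0 < k -> (forall w, `|l w| <= k * `|w|) ->
  open O -> C1_on O f -> O p -> forall e, 0 < e ->
  exists2 d, 0 < d & forall q q', ball p d q -> ball p d q' ->
    `|l (f q - f q' - 'd f p (q - q'))| <= e * `|q - q'|.
Proof.
move=> ll k0 lk oO fC Op e e0.
have lB u v : l u - l v = l (u - v).
  exact: (esym (linearB (pack_linear ll) u v)).
have lZ (a : R) w : l (a *: w) = a * l w.
  exact: (linearZ_LR (pack_linear ll)).
have ek0 : 0 < e / k by rewrite divr_gt0.
have : nbhs p [set z | (forall v, `|'d f z v - 'd f p v| <= e / k * `|v|) /\ O z].
  exact: filterI ((fC p Op).2 _ ek0) (open_nbhs_nbhs (conj oO Op)).
move=> /nbhs_ballP[d /= d0 H]; exists d => // q q' qd qd'.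
pose v := q - q'.
pose h t := l (f (q' + t *: v)) - t * l ('d f p v).
pose dh t := l ('d f (q' + t *: v) v - 'd f p v).
have hd (t : R) : 0 <= t <= 1 -> is_derive t 1 h (dh t).
  move=> t01; have [_ Oz] := H _ (ball_segment t01 qd qd').
  have lin : linear (fun s : R => s * dh t : R).
    by move=> a u w; rewrite mulrDl /GRing.scale/= mulrA.
  have := @approx_differentiable R R R h t (pack_linear lin).
  have cl : continuous (pack_linear lin).
    by move=> s; apply: cvgM; [exact: cvg_id|exact: cvg_cst].
  move=> /(_ cl)[e1 e10|df dE].
    have ev : 0 < e1 / (k * (`|v| + 1)) by rewrite divr_gt0// mulr_gt0// ltr_wpDl.
    have /near0P[n Hn] := differentiable_approx (fC _ Oz).1 ev.
    have v1 : 0 < `|v| + 1 by rewrite ltr_wpDl.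
    have n0 : 0 < n.+1%:R^-1 :> R by rewrite invr_gt0.
    have [m Hm] := inv_succ_le (divr_gt0 n0 v1).
    apply/near0P; exists m => s sm /=.
    have sv : `|s *: v| <= n.+1%:R^-1.
      rewrite normrZ (le_trans (ler_wpM2l _ (ler_wpDr ler01 (lexx `|v|))))//.
      by rewrite -ler_pdivlMr// (le_trans sm).
    have := Hn _ sv.
    rewrite (_ : _ - _ = l (f (q' + t *: v + s *: v) - f (q' + t *: v) -
        'd f (q' + t *: v) (s *: v))).
      move=> Hs; rewrite (le_trans (lk _))//.
      rewrite (le_trans (ler_wpM2l (ltW k0) Hs))// normrZ.
      rewrite (_ : k * (e1 / (k * (`|v| + 1)) * (`|s| * `|v|)) =
          e1 * `|s| * (`|v| / (`|v| + 1))); last first.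
        by field; rewrite !gt_eqF.
      rewrite ler_piMr ?mulr_ge0 ?(ltW e10)// ler_pdivrMr// mul1r lerDl//.
    have -> : 'd f (q' + t *: v) (s *: v) = s *: 'd f (q' + t *: v) v.
      exact: linearZ.
    by rewrite /h /dh -!lB lZ scalerDl addrA; ring.
  have -> : dh t = 'D_1 h t by rewrite deriveE// dE/= mul1r.
  by apply: derivableP; exact/derivable1_diffP.
have [||c c01] := @MVT R h dh 0 1 ltr01.
- by move=> t; rewrite in_itv/= => /andP[t0 t1]; apply: hd; rewrite !ltW.
- apply: derivable_within_continuous => t; rewrite in_itv/= => t01.
  by have [] := hd t t01.
rewrite subr0 mulr1 => E.
have -> : l (f q - f q' - 'd f p (q - q')) = h 1 - h 0.
  rewrite /h scale1r scale0r addr0.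
  have -> : q' + v = q by rewrite addrC subrK.
  rewrite mul0r mul1r subr0 -!lB.
  by ring.
rewrite E /dh (le_trans (lk _))// mulrC -ler_pdivlMr// mulrAC.
have {}c01 : 0 <= c <= 1.
  by move: c01; rewrite in_itv/= => /andP[? ?]; rewrite !ltW.
have [Hc _] := H _ (ball_segment c01 qd qd').
exact: Hc.
Qed.

(** The scalar estimate, coordinate by coordinate. [W] may be a product with the max norm, so [l]
    first sends it to a Hilbert space; below, [l] is the first projection or the identity. *)
Lemma C1_strict_proj (V W : normedModType R) (Z : finHilbertType R) (O : set V)
    (f : V -> W) (l : W -> Z) k p :
  linear l -> 0 < k -> (forall w, `|l w| <= k * `|w|) ->
  open O -> C1_on O f -> O p -> forall e, 0 < e ->
  exists2 d, 0 < d & forall q q', ball p d q -> ball p d q' ->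
    `|l (f q - f q' - 'd f p (q - q'))| <= e * `|q - q'|.
Proof.
move=> ll k0 lk oO fC Op e e0.
have [kz kz0 bz] := @vcoord_bounded R Z.
pose B := \sum_(j < \dim {:Z}) `|basis_vec j : Z|.
have B0 : 0 <= B by rewrite sumr_ge0.
have B1 : 0 < B + 1 by rewrite ltr_wpDl.
have eB : 0 < e / (B + 1) by rewrite divr_gt0.
have /choice[d Hd] j : exists d, 0 < d /\ forall q q', ball p d q -> ball p d q' ->
    `|vcoord j (l (f q - f q' - 'd f p (q - q')))| <= e / (B + 1) * `|q - q'|.
  have [|||d d0 Hd] := @C1_strict_scalar V W O f (vcoord j \o l) (kz * k) p
    _ _ _ oO fC Op _ eB.
  - by move=> a u v /=; rewrite ll vcoord_linear.
  - by rewrite mulr_gt0.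
  - by move=> w /=; rewrite (le_trans (bz _ _))// -mulrA ler_wpM2l// ltW.
  by exists d.
have [d0 d00 le_d] := finite_lower_bound (fun j => (Hd j).1).
exists d0 => // q q' qd qd'.
rewrite [X in `|X|]vcoord_sum (le_trans (ler_norm_sum _ _ _))//.
apply: (@le_trans _ _ (\sum_(j < \dim {:Z})
    (e / (B + 1) * `|q - q'|) * `|basis_vec j : Z|)).
  apply: ler_sum => j _; rewrite normrZ ler_wpM2r//.
  by apply: (Hd j).2; apply: (le_ball (le_d j)).
rewrite -mulr_sumr -/B mulrAC ler_wpM2r// mulrAC ler_pdivrMr//.
by rewrite ler_wpM2l ?(ltW e0)// lerDl.
Qed.

End StrictDerivative.

(** * Parametrized sets and Lipschitzian manifolds *)

Section Parametrization.
Context {R : realType} {X Y : finHilbertType R}.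
Variables (Omega : set X) (F : Y -> X) (G : X -> Y).

(** The approximate preimages stay in a ball, so they cluster, and a cluster point is an exact
    preimage by continuity of [B]. *)
Lemma linear_range_closed (B : Y -> X) (r : R) v : linear B ->
  (forall e, 0 < e -> exists2 u, `|u| <= r & `|B u - v| <= e) ->
  exists u, B u = v.
Proof.
move=> lB H.
have [k k0 bB] := finite_linear_bounded lB.
have /choice[u Hu] n : exists u, `|u| <= r /\ `|B u - v| <= n.+1%:R^-1.
  by have [|u ur uv] := H n.+1%:R^-1; [rewrite invr_gt0|exists u].
have [|w _ Hw] := @bounded_cluster R Y nat \oo _ u r.
  by apply: nearW => n; exact: (Hu n).1.
exists w; apply/eqP; rewrite -subr_eq0 -normr_le0; apply/ler_addgt0Pr => e e0.
rewrite add0r.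
have e2 : 0 < e / 2 by rewrite divr_gt0.
have ek : 0 < e / 2 / (k + 1) by rewrite divr_gt0// ltr_wpDl.
have [n0 Hn0] := inv_succ_le e2.
have [|n nn0 uw] := Hw [set n | (n0 <= n)%N] _ _ ek.
  by exists n0 => // n /=.
have BB : B (u n) - B w = B (u n - w).
  exact: (esym (linearB (pack_linear lB) (u n) w)).
rewrite (_ : B w - v = (B (u n) - v) - B (u n - w)); last first.
  by rewrite -BB opprB [RHS]addrC subrKA.
rewrite (le_trans (ler_normB _ _))// [leRHS]splitr lerD//.
  rewrite (le_trans (Hu n).2)// (le_trans _ Hn0)//.
  by rewrite lef_pV2 ?posrE// ler_nat ltnS.
rewrite (le_trans (bB _))//.
apply: (@le_trans _ _ ((k + 1) * (e / 2 / (k + 1)))).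
  by rewrite ler_pM// ?lerDl// ltW.
by rewrite mulrC divfK// gt_eqF// ltr_wpDl.
Qed.

(* The filter [FF] of base points is either concentrated at one point, which
   yields tangent cones, or consists of all points of Omega near a given one,
   which yields the regular and paratingent cones. *)
Variables (FF : set_system X) (B : Y -> X) (k : R).
Hypotheses (FFF : Filter FF) (linB : linear B) (k0 : 0 <= k).
Hypothesis paramF : forall e, 0 < e -> exists2 d, 0 < d & \forall x \near FF,
  F (G x) = x /\ forall u, `|u| < d ->
    Omega (F (G x + u)) /\ `|F (G x + u) - F (G x) - B u| <= e * `|u|.
Hypothesis paramG : exists2 d, 0 < d & \forall x \near FF,
  forall x', Omega x' -> `|x' - x| < d -> F (G x') = x' /\
    `|G x' - G x| <= k * `|x' - x|.

Local Notation dq := (fun p : X * R => diff_quotient Omega p.1 p.2).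

(** From [x = F (G x)], the parameter step [t *: u] leads to a point of [Omega] whose difference
    quotient is within [e1 * |u|] of [B u]. *)
Lemma range_sub_inner : range B `<=` inner_limit (filter_prod FF 0^'+) dq.
Proof.
move=> _ [u _ <-]; apply/inner_limitP => e e0.
have u1 : 0 < `|u| + 1 by rewrite ltr_wpDl.
pose e1 := e / (2 * (`|u| + 1)).
have e10 : 0 < e1 by rewrite divr_gt0// mulr_gt0.
have BZ (t : R) : B (t *: u) = t *: B u.
  exact: (linearZ_LR (pack_linear linB)).
have [d d0 Hd] := paramF e10.
exists ([set x | F (G x) = x /\ forall u, `|u| < d ->
    Omega (F (G x + u)) /\ `|F (G x + u) - F (G x) - B u| <= e1 * `|u|],
    [set t | 0 < t < d / (`|u| + 1)]) => /=.
  by split => //; apply/at_right0P; exists (d / (`|u| + 1)) => //; rewrite divr_gt0.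
move=> [x t] /= [[FGx Hx] /andP[t0 td]].
have tu : `|t *: u| < d.
  rewrite normrZ gtr0_norm// (le_lt_trans _ (_ : t * (`|u| + 1) < d))//.
    by rewrite ler_wpM2l ?lerDl// ltW.
  by rewrite -ltr_pdivlMr.
have [Oy Hy] := Hx _ tu.
exists (t^-1 *: (F (G x + t *: u) - x)); first by exists (F (G x + t *: u)).
rewrite (_ : _ - B u = t^-1 *: (F (G x + t *: u) - F (G x) - B (t *: u))).
  rewrite normrZ gtr0_norm ?invr_gt0// ltr_pdivrMl// (le_lt_trans Hy)//.
  rewrite normrZ gtr0_norm// mulrCA ltr_pM2l// /e1 -mulrA gtr_pMr//.
  rewrite ltr_pdivrMl ?mulr_gt0// mulr1; have := normr_ge0 u; lra.
by rewrite FGx [RHS]scalerBr BZ scalerK// gt_eqF.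
Qed.

(** Difference quotients near [v] are bounded, so by the Lipschitz bound on [G] the parameter
    increments divided by [t] are bounded too; [B] sends them close to [v], and its range is
    closed. *)
Lemma outer_sub_range : outer_limit (filter_prod FF 0^'+) dq `<=` range B.
Proof.
move=> v /outer_limitP H.
pose r := k * (`|v| + 1).
have v1 : 0 < `|v| + 1 by rewrite ltr_wpDl.
have r0 : 0 <= r by rewrite mulr_ge0// ltW.
have r1 : 0 < r + 1 by rewrite ltr_wpDl.
suff [u Bu] : exists u, B u = v by exists u.
apply: (linear_range_closed (r := r)) => // e e0.
pose e1 := e / (2 * (r + 1)).
have e10 : 0 < e1 by rewrite divr_gt0// mulr_gt0.
have [d1 d10 H1] := paramF e10; have [d2 d20 H2] := paramG.
(* Small enough for [|y - x|] to be below [d2] and [|G y - G x|] below [d1]. *)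
pose t0 := Num.min (d2 / (`|v| + 1)) (d1 / (r + 1)).
have t00 : 0 < t0 by rewrite lt_min !divr_gt0.
pose e2 := Num.min 1 (e / 2).
have e20 : 0 < e2 by rewrite lt_min ltr01 divr_gt0.
pose P := [set x | (F (G x) = x /\ forall u, `|u| < d1 ->
    Omega (F (G x + u)) /\ `|F (G x + u) - F (G x) - B u| <= e1 * `|u|) /\
  (forall x', Omega x' -> `|x' - x| < d2 -> F (G x') = x' /\
    `|G x' - G x| <= k * `|x' - x|)].
have [|[x t] [w [[[[FGx Hx] Gx] /= /andP[tp tt]] [y Oy yw] wv]]] :=
    H (P `*` [set t | 0 < t < t0]) _ e2 e20.
  exists (P, [set t | 0 < t < t0]) => //=; split.
    exact: filterI H1 H2.
  by apply/at_right0P; exists t0.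
move: tt wv; rewrite -yw /= !lt_min => /andP[td2 td1] /andP[q1 qe].
have qv : `|t^-1 *: (y - x)| <= `|v| + 1.
  by rewrite -lerBlDl (le_trans (lerB_dist _ _))// ltW.
have yx : `|y - x| <= t * (`|v| + 1).
  by rewrite -ler_pdivrMl// -{1}(gtr0_norm (x := t^-1)) ?invr_gt0// -normrZ.
have yd : `|y - x| < d2 by rewrite (le_lt_trans yx)// -ltr_pdivlMr.
have [FGy Gyx] := Gx y Oy yd.
have wr : `|G y - G x| <= t * r.
  by rewrite (le_trans Gyx)// /r mulrCA ler_wpM2l.
have wd : `|G y - G x| < d1.
  rewrite (le_lt_trans wr)// (le_lt_trans _ (_ : t * (r + 1) < d1))//.
    by rewrite ler_wpM2l ?lerDl// ltW.
  by rewrite -ltr_pdivlMr.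
have [_] := Hx _ wd; rewrite [G x + _]addrC subrK FGy FGx => Hw.
have BZ z : B (t^-1 *: z) = t^-1 *: B z.
  exact: (linearZ_LR (pack_linear linB)).
exists (t^-1 *: (G y - G x)).
  by rewrite normrZ gtr0_norm ?invr_gt0// ler_pdivrMl.
rewrite (_ : _ - v = (t^-1 *: (y - x) - v) -
  (t^-1 *: (y - x - B (G y - G x)))); last first.
  by rewrite BZ (scalerBr _ (y - x) (B _)) opprB [RHS]addrC subrKA.
rewrite (le_trans (ler_normB _ _))// [leRHS]splitr lerD//; first exact: ltW.
rewrite normrZ gtr0_norm ?invr_gt0// ler_pdivrMl// (le_trans Hw)//.
apply: (le_trans (ler_wpM2l (ltW e10) wr)).
rewrite mulrCA ler_wpM2l ?(ltW tp)// /e1 mulrAC ler_pdivrMr ?mulr_gt0//.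
rewrite (_ : e / 2 * (2 * (r + 1)) = e * (r + 1)); last by field.
by rewrite ler_wpM2l ?lerDl// ltW.
Qed.

End Parametrization.

Section ParamCones.
Context {R : realType} {X : finHilbertType R}.
Implicit Types (Omega : set X) (x : X).

Local Notation dq Omega := (fun p : X * R => diff_quotient Omega p.1 p.2).

Lemma tangent_sub_point Omega x : tangent_cone Omega x `<=`
  outer_limit (filter_prod (globally [set x]) 0^'+) (dq Omega).
Proof.
move=> v /outer_limitP H; apply/outer_limitP => A [[P Q]/= [Px Q0] PQ] e e0.
have [t [w [Qt dw wv]]] := H Q Q0 e e0.
by exists (x, t), w; split => //; apply: PQ; split => //; exact: Px.
Qed.

Lemma point_sub_derivable Omega x :
  inner_limit (filter_prod (globally [set x]) 0^'+) (dq Omega) `<=`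
  derivable_cone Omega x.
Proof.
move=> v /inner_limitP H; apply/inner_limitP => e e0.
have [[P Q]/= [Px Q0] PQ] := H e e0.
by apply: filterS Q0 => t Qt; apply: (PQ (x, t)); split => //; exact: Px.
Qed.

Lemma param_tangent (Y : finHilbertType R) Omega x (F : Y -> X) (G : X -> Y)
    (B : Y -> X) k : linear B -> 0 <= k -> F (G x) = x ->
  (forall e, 0 < e -> exists2 d, 0 < d & forall u, `|u| < d ->
    Omega (F (G x + u)) /\ `|F (G x + u) - F (G x) - B u| <= e * `|u|) ->
  (exists2 d, 0 < d & forall x', Omega x' -> `|x' - x| < d -> F (G x') = x' /\
    `|G x' - G x| <= k * `|x' - x|) ->
  derivable_at Omega x /\ tangent_cone Omega x = range B.
Proof.
move=> lB k0 FGx hF [dG dG0 hG].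
have h1 : tangent_cone Omega x `<=` range B.
  apply: subset_trans (@tangent_sub_point Omega x) _.
  apply: (outer_sub_range (G := G) (F := F) (k := k)) => //.
    move=> e /hF[d d0 Hd]; exists d => // _ ->.
    by split.
  by exists dG => // _ ->.
have h2 : range B `<=` derivable_cone Omega x.
  apply: subset_trans (@point_sub_derivable Omega x).
  apply: (range_sub_inner (G := G) (F := F)) => //.
  move=> e /hF[d d0 Hd]; exists d => // _ ->.
  by split.
have h3 := @derivable_sub_tangent R X Omega x.
split; apply/seteqP; split => //.
  exact: subset_trans h1 h2.
exact: subset_trans h2 h3.
Qed.

End ParamCones.

Lemma near_distP (R : realType) (V : normedModType R) (x : V) (P : V -> Prop) :
  (\forall y \near x, P y) <-> exists2 d, 0 < d & forall y, `|y - x| < d -> P y.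
Proof.
split=> [/nbhs_ballP[d /= d0 H]|[d d0 H]].
  by exists d => // y yd; apply: H; rewrite -ball_normE/= distrC.
by apply/nbhs_ballP; exists d => //= y; rewrite -ball_normE/= distrC; exact: H.
Qed.

Lemma diff_near_id (R : realType) (V : normedModType R) (h : V -> V) (x : V) :
  (\forall y \near x, h y = y) -> 'd h x = id :> (V -> V).
Proof.
move=> hx; have [] // := @approx_differentiable R V V h x idfun.
  by move=> z; exact: cvg_id.
have [d d0 Hd] := (near_distP x _).1 hx.
move=> e e0; apply/near_distP; exists d => // u; rewrite subr0 => ud.
rewrite (Hd (x + u)); last by rewrite [x + u]addrC addrK.
rewrite (Hd x); last by rewrite subrr normr0.
by rewrite [x + u]addrC addrK subrr normr0 mulr_ge0// ltW.
Qed.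

(** The derivative inherits the bound near 0 up to a slack, then everywhere by homogeneity. *)
Lemma diff_bounded (R : realType) (V W : normedModType R) (f : V -> W) (x : V) L :
  0 <= L -> differentiable f x ->
  (\forall y \near x, `|f y - f x| <= L * `|y - x|) ->
  forall u, `|'d f x u| <= L * `|u|.
Proof.
move=> L0 df fL u; apply/ler_addgt0Pr => e e0.
have u1 : 0 < `|u| + 1 by rewrite ltr_wpDl.
have eu : 0 < e / (`|u| + 1) by rewrite divr_gt0.
suff : `|'d f x u| <= (L + e / (`|u| + 1)) * `|u|.
  move=> /le_trans; apply; rewrite mulrDl lerD2l mulrAC ler_pdivrMr//.
  by rewrite ler_wpM2l ?lerDl// ltW.
apply: (@near0_homogeneous _ _ (fun u => `|'d f x u|)
  (fun v => (L + e / (`|u| + 1)) * `|v|)) => [c w c0|c w c0|].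
- have -> : 'd f x (c *: w) = c *: 'd f x w by exact: linearZ.
  by rewrite normrZ gtr0_norm.
- by rewrite normrZ gtr0_norm// mulrCA.
have [d d0 Hd] := (near_distP x _).1 fL.
have [d' d'0 Hd'] := (near_distP 0 _).1 (differentiable_approx df eu).
apply/near_distP; exists (Num.min d d'); first by rewrite lt_min d0.
move=> w; rewrite lt_min subr0 => /andP[wd wd'].
have h1 := Hd (x + w); rewrite [x + w]addrC addrK in h1.
have h2 := Hd' w; rewrite subr0 [x + w]addrC in h2.
rewrite (_ : 'd f x w = (f (w + x) - f x) - (f (w + x) - f x - 'd f x w)); last first.
  by rewrite opprB addrC subrK.
by rewrite (le_trans (ler_normB _ _))// mulrDl lerD// ?h1 ?h2.
Qed.

Lemma linear_pair_sub (R : realType) (Y Z X : normedModType R)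
    (D D' : {linear (Y * Z)%type -> X}) u z z' :
  D' (u, z') - D (u, z) = (D' (u, z') - D (u, z')) + D (0, z' - z).
Proof.
have -> : (0, z' - z) = (u, z') - (u, z) by rewrite -[RHS]/(u - u, z' - z) subrr.
by rewrite linearB subrKA.
Qed.

(** * Lipschitzian manifolds through a chart *)

Section Manifold.
Context {R : realType} {X Y Z : finHilbertType R}.
Variables (Omega O : set X) (xbar : X) (U' : set Y) (U'' : set Z).
Variables (Phi : X -> Y * Z) (g : Y * Z -> X) (f : Y -> Z) (L : R).
Hypotheses (oO : open O) (Oxbar : O xbar) (Omega_xbar : Omega xbar).
Hypothesis oU : open (U' `*` U'').
Hypothesis gK : forall x, O x -> g (Phi x) = x.
Hypothesis Kg : forall u, (U' `*` U'') u -> O (g u) /\ Phi (g u) = u.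
Hypotheses (Phi_C1 : C1_on O Phi) (g_C1 : C1_on (U' `*` U'') g).
Hypotheses (fU : forall y, U' y -> U'' (f y)) (L0 : 0 <= L).
Hypothesis fL : forall y y', U' y -> U' y' -> `|f y - f y'| <= L * `|y - y'|.
Hypothesis graph_Phi :
  Phi @` (Omega `&` O) = graph_on U' f `&` (U' `*` U'').

Let F y := g (y, f y).
(** Taken from [Phi] rather than as an inverse of [F], so that its Lipschitz bound comes from the C1
    regularity of [Phi] alone. *)
Let G x := (Phi x).1.
Let ybar := G xbar.
Let pbar := (ybar, f ybar).

Let Phi_graph x : Omega x -> O x -> U' (G x) /\ Phi x = (G x, f (G x)).
Proof.
move=> Ox OOx; have : (Phi @` (Omega `&` O)) (Phi x) by exists x.
rewrite graph_Phi => -[[H1 H2] _]; split => //.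
by rewrite [LHS]surjective_pairing H2.
Qed.

Let FG x : Omega x -> O x -> F (G x) = x.
Proof.
by move=> Ox OOx; have [_ E] := Phi_graph Ox OOx; rewrite /F -E gK.
Qed.

Let FOmega y : U' y -> [/\ Omega (F y), O (F y) & G (F y) = y].
Proof.
move=> Uy; have : (graph_on U' f `&` (U' `*` U'')) (y, f y).
  by split; [split|split => //=; exact: fU].
rewrite -graph_Phi => -[x [Ox OOx] E].
by rewrite /F -E gK// /G E.
Qed.

Let U_ybar : U' ybar. Proof. by have [] := Phi_graph Omega_xbar Oxbar. Qed.

Let F_ybar : F ybar = xbar. Proof. exact: FG. Qed.

Let U_p y : U' y -> (U' `*` U'') (y, f y).
Proof. by move=> Uy; split => //=; exact: fU. Qed.

(** Only the product is assumed open; its slice at height [f ybar] is [U']. *)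
Let oU' : open U'.
Proof.
have -> : U' = (fun y => (y, f ybar)) @^-1` (U' `*` U'').
  apply/seteqP; split => [y Uy|y [] //].
  by split => //=; exact: fU.
apply: open_comp => // y _.
by apply: (@cvg_pair _ _ _ _ (nbhs y) (nbhs (f ybar))); [exact: cvg_id|exact: cvg_cst].
Qed.

Let pair_norm (u : Y) (v : Z) : `|v| <= L * `|u| -> `|(u, v)| <= (1 + L) * `|u|.
Proof.
move=> vu; rewrite prod_normE/= ge_max mulrDl mul1r lerDl mulr_ge0//=.
by rewrite (le_trans vu)// lerDr.
Qed.

Let pair_dist y y' : U' y -> U' y' ->
  `|(y, f y) - (y', f y')| <= (1 + L) * `|y - y'|.
Proof. by move=> Uy Uy'; apply: pair_norm; exact: fL. Qed.

Let L1 : 0 < 1 + L. Proof. by rewrite ltr_pwDl. Qed.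

(** Strict differentiability of [Phi] with tolerance 1 bounds increments by a bound on the
    derivative plus 1. *)
Let G_lip x0 : O x0 -> exists2 k, 0 <= k & exists2 d, 0 < d &
  forall x x', `|x - x0| < d -> `|x' - x0| < d -> O x /\
    `|G x - G x'| <= k * `|x - x'|.
Proof.
move=> Ox0; have [d1 d10 H1] := (near_distP x0 _).1 (open_nbhs_nbhs (conj oO Ox0)).
have lfst : linear (fst : Y * Z -> Y) by [].
have bfst (w : Y * Z) : `|w.1| <= 1 * `|w|.
  by rewrite mul1r prod_normE le_max lexx.
have [d d0 H] := C1_strict_proj lfst ltr01 bfst oO Phi_C1 Ox0 ltr01.
have [k k0 Hk] := linear_lipschitz (diff_continuous (Phi_C1 Ox0).1).
exists (k + 1); first by rewrite addr_ge0// ltW.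
exists (Num.min d d1); first by rewrite lt_min d0.
move=> x x'; rewrite !lt_min => /andP[xd xd1] /andP[x'd x'd1]; split; first exact: H1.
have := H x x'; rewrite -!ball_normE/= ![`|x0 - _|]distrC => /(_ xd x'd).
rewrite mul1r /= => Hx.
rewrite (_ : G x - G x' = ((Phi x).1 - (Phi x').1 - ('d Phi x0 (x - x')).1) +
  ('d Phi x0 (x - x')).1); last by rewrite subrK.
rewrite (le_trans (ler_normD _ _))// mulrDl mul1r addrC lerD//.
by rewrite (le_trans (bfst _))// mul1r.
Qed.

Let f_cont y : U' y -> {for y, continuous f}.
Proof.
move=> Uy; apply/cvgrPdist_lt => e e0.
have [d d0 H] := (near_distP y _).1 (open_nbhs_nbhs (conj oU' Uy)).
apply/near_distP; exists (Num.min d (e / (1 + L))); first by rewrite lt_min d0 divr_gt0.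
move=> y'; rewrite lt_min => /andP[yd ye]; rewrite distrC.
rewrite (le_lt_trans (fL (H _ yd) Uy))// (le_lt_trans _ (_ : (1 + L) * `|y' - y| < e))//.
  by rewrite ler_wpM2r// lerDr.
by rewrite mulrC -ltr_pdivlMr.
Qed.

Let p_cont y : U' y -> (fun y' => (y', f y')) y' @[y' --> y] --> (y, f y).
Proof.
move=> Uy; apply: (@cvg_pair _ _ _ _ (nbhs y) (nbhs (f y))); first exact: cvg_id.
exact: f_cont.
Qed.

Let F_cont y : U' y -> {for y, continuous F}.
Proof.
move=> Uy; apply: (continuous_comp (p_cont Uy)).
exact: differentiable_continuous (g_C1 (U_p Uy)).1.
Qed.

Let F_diff y : U' y -> differentiable f y ->
  differentiable F y /\ forall u, 'd F y u = 'd g (y, f y) (u, 'd f y u).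
Proof.
move=> Uy df.
have dp : differentiable (fun y => (y, f y)) y by exact: differentiable_pair.
have dg := (g_C1 (U_p Uy)).1.
split; first exact: (differentiable_comp dp dg).
move=> u; rewrite (diff_comp dp dg)/= diff_pair//=.
by rewrite (@diff_near_id R Y (fun y => y) y)//; exact: nearW.
Qed.

(** The base point is fixed here, so mere differentiability of [F] at [y] suffices; the range of its
    derivative is a subspace. *)
Let smooth_F y : U' y -> differentiable f y ->
  smooth_at Omega (F y) /\ tangent_cone Omega (F y) = range ('d F y).
Proof.
move=> Uy df; have [dF _] := F_diff Uy df.
have [OF OOF GF] := FOmega Uy.
have [k k0 [d d0 Hd]] := G_lip OOF.
have [||||hD hT] := @param_tangent R X Y Omega (F y) F G ('d F y) k _ k0 _ _ _.
- by move=> a u v; rewrite linearP.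
- by rewrite GF.
- move=> e e0; rewrite GF.
  have [d1 d10 H1] := (near_distP 0 _).1 (differentiable_approx dF e0).
  have [d2 d20 H2] := (near_distP y _).1 (open_nbhs_nbhs (conj oU' Uy)).
  exists (Num.min d1 d2); first by rewrite lt_min d10.
  move=> u; rewrite lt_min => /andP[u1 u2]; split; last by apply: H1; rewrite subr0.
  by have [] // := @FOmega (y + u) _; apply: H2; rewrite addrC addKr.
- exists d => // x' Ox' xd; have := Hd x' (F y) xd.
  rewrite subrr normr0 => /(_ d0)[OOx' Hx]; split => //.
  exact: FG.
split => //; split => //; rewrite hT; apply: vspace_of_set.
  by exists 0 => //; rewrite linear0.
by move=> c _ _ [u _ <-] [v _ <-]; exists (c *: u + v) => //; rewrite linearP.
Qed.

Lemma smooth_dense d : 0 < d ->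
  exists2 x, `|x - xbar| < d & (Omega `&` [set x | smooth_at Omega x]) x.
Proof.
move=> d0; have nd : nbhs ybar [set y | `|F y - xbar| < d].
  have : F y @[y --> ybar] --> F ybar by exact: F_cont.
  rewrite F_ybar => /cvgrPdist_lt/(_ d d0).
  by apply: filterS => y /=; rewrite distrC.
have [y [yd Uy df]] := lipschitz_diff_dense oU' U_ybar L0 fL nd.
exists (F y) => //; split; first by have [] := FOmega Uy.
exact: (smooth_F Uy df).1.
Qed.

(** Strict differentiability of [f] and of [g] combine to that of [F], an expansion uniform in the
    base point; this is what cones with a moving base point require. *)
Lemma strict_graph_strictly_smooth (A : Y -> Z) : linear A ->
  (forall e, 0 < e -> exists2 d, 0 < d & forall y y', `|y - ybar| < d ->
    `|y' - ybar| < d -> `|f y - f y' - A (y - y')| <= e * `|y - y'|) ->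
  strictly_smooth_at Omega xbar.
Proof.
move=> lA fA.
pose B u := 'd g pbar (u, A u).
have lB : linear B.
  move=> a u v; rewrite /B lA -linearP; congr ('d g pbar _).
have dg := (g_C1 (U_p U_ybar)).1.
have [kg kg0 Hg] := linear_lipschitz (diff_continuous dg).
have dgB u v : 'd g pbar u - 'd g pbar v = 'd g pbar (u - v).
  exact: (esym (linearB _ u v)).
have [dU dU0 HU] := (near_distP ybar _).1 (open_nbhs_nbhs (conj oU' U_ybar)).
have strictF e : 0 < e -> exists2 d, 0 < d & forall y y', `|y - ybar| < d ->
    `|y' - ybar| < d -> [/\ U' y, U' y' & `|F y - F y' - B (y - y')| <= e * `|y - y'|].
  move=> e0.
  (* One half of [e] is for [g] along the graph, whose increments are at most [1 + L] times those of
     [y]; the other is for the defect of [f], enlarged by [kg]. *)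
  have e1 : 0 < e / (2 * (1 + L)) by rewrite divr_gt0// mulr_gt0.
  have e2 : 0 < e / (2 * kg) by rewrite divr_gt0// mulr_gt0.
  have lid : linear (id : X -> X) by [].
  have bid (w : X) : `|w| <= 1 * `|w| by rewrite mul1r.
  have [d1 d10 H1] := C1_strict_proj lid ltr01 bid oU g_C1 (U_p U_ybar) e1.
  have [d2 d20 H2] := fA _ e2.
  exists (Num.min dU (Num.min (d1 / (1 + L)) d2)).
    by rewrite !lt_min dU0 d20 divr_gt0.
  move=> y y'; rewrite !lt_min => /and3P[yU y1 y2] /and3P[y'U y'1 y'2].
  have [Uy Uy'] := (HU _ yU, HU _ y'U); split => //.
  have pd z : U' z -> `|z - ybar| < d1 / (1 + L) -> ball pbar d1 (z, f z).
    move=> Uz zd; rewrite -ball_normE/= distrC.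
    by rewrite (le_lt_trans (pair_dist Uz U_ybar))// mulrC -ltr_pdivlMr.
  have h1 := H1 _ _ (pd _ Uy y1) (pd _ Uy' y'1).
  have h2 := H2 _ _ y2 y'2.
  rewrite (_ : F y - F y' - B (y - y') =
    (g (y, f y) - g (y', f y') - 'd g pbar ((y, f y) - (y', f y'))) +
    'd g pbar (0, f y - f y' - A (y - y'))); last first.
    have -> : B (y - y') = 'd g pbar ((y, f y) - (y', f y')) -
        'd g pbar (0, f y - f y' - A (y - y')).
      rewrite dgB /B; congr ('d g pbar _).
      rewrite -[RHS]/(y - y' - 0, f y - f y' - (f y - f y' - A (y - y'))).
      by rewrite subr0 subKr.
    by rewrite opprB ['d g pbar (0, _) - _]addrC addrA.
  rewrite (le_trans (ler_normD _ _))// [leRHS]splitr lerD//.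
    rewrite (le_trans h1)// (le_trans (ler_wpM2l (ltW e1) (pair_dist Uy Uy')))//.
    rewrite (_ : e / (2 * (1 + L)) * _ = e * `|y - y'| / 2)//.
    by field; rewrite gt_eqF.
  rewrite (le_trans (Hg _))// prod_normE/= normr0 max_r//.
  rewrite (le_trans (ler_wpM2l (ltW kg0) h2))//.
  rewrite (_ : kg * _ = e * `|y - y'| / 2)//.
  by field; rewrite gt_eqF.
have [k k0 [dG dG0 HG]] := G_lip Oxbar.
have k1 : 0 < k + 1 by rewrite ltr_wpDl.
have FF : Filter (within Omega (nbhs xbar)) by exact: within_filter.
have hF e : 0 < e -> exists2 d, 0 < d & \forall x \near within Omega (nbhs xbar),
  F (G x) = x /\ forall u, `|u| < d ->
    Omega (F (G x + u)) /\ `|F (G x + u) - F (G x) - B u| <= e * `|u|.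
  (* Halving [d] keeps both [G x] and [G x + u] within [d] of [ybar]. *)
  move=> /strictF[d d0 Hd]; exists (d / 2); first by rewrite divr_gt0.
  apply/withinP_dist; exists (Num.min dG (d / 2 / (k + 1))).
    by rewrite lt_min dG0 !divr_gt0.
  move=> x; rewrite lt_min => /andP[xG xd] Ox.
  have [OOx HGx] := HG x xbar xG (ltac:(by rewrite subrr normr0)).
  split; first exact: FG.
  have Gx : `|G x - ybar| < d / 2.
    rewrite (le_lt_trans HGx)// (le_lt_trans _ (_ : (k + 1) * `|x - xbar| < d / 2))//.
      by rewrite ler_wpM2r// lerDl.
    by rewrite mulrC -ltr_pdivlMr.
  move=> u ud.
  have [||Uu Ux] := Hd (G x + u) (G x).
  - rewrite addrAC (le_lt_trans (ler_normD _ _))// [ltRHS]splitr ltrD//.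
  - by rewrite (lt_trans Gx)// ltr_pdivrMr// ltr_pMr// ltr1n.
  rewrite [G x + u - G x]addrC addKr; split => //.
  by have [] := FOmega Uu.
have hG : exists2 d, 0 < d & \forall x \near within Omega (nbhs xbar),
  forall x', Omega x' -> `|x' - x| < d -> F (G x') = x' /\
    `|G x' - G x| <= k * `|x' - x|.
  exists (dG / 2); first by rewrite divr_gt0.
  apply/withinP_dist; exists (dG / 2); first by rewrite divr_gt0.
  move=> x xd Ox x' Ox' x'd.
  have [||OOx' H] := HG x' x.
  - rewrite -(subrKA x) (le_lt_trans (ler_normD _ _))// [ltRHS]splitr ltrD//.
  - by rewrite (lt_trans xd)// ltr_pdivrMr// ltr_pMr// ltr1n.
  by split => //; exact: FG.
have h1 : paratingent_cone Omega xbar `<=` range B.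
  exact: (outer_sub_range (G := G) (F := F) (k := k)).
have h2 : range B `<=` regular_tangent_cone Omega xbar.
  exact: (range_sub_inner (G := G) (F := F)).
have h3 := regular_sub_derivable Omega_xbar.
have h4 := @derivable_sub_tangent R X Omega xbar.
have h5 := tangent_sub_paratingent Omega_xbar.
apply/seteqP; split; last exact: subset_trans h1 h2.
exact: subset_trans h3 (subset_trans h4 h5).
Qed.

Let E y := U' y /\ differentiable f y.

Let E_proper : ProperFilter (within E (nbhs ybar)).
Proof.
apply: within_proper => d d0.
have nd : nbhs ybar [set y | `|y - ybar| < d] by apply/near_distP; exists d.
by have [y [yd Uy df]] := lipschitz_diff_dense oU' U_ybar L0 fL nd; exists y.
Qed.

Let diff_f_bounded y u : E y -> `|'d f y u| <= L * `|u|.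
Proof.
move=> [Uy df]; apply: diff_bounded => //.
apply: filterS (open_nbhs_nbhs (conj oU' Uy)) => y' Uy'.
exact: fL.
Qed.

(** Chain rule for [Phi \o g], the identity near [(y, f y)]; it reads a tangent vector as a point of
    the graph of ['d f y]. *)
Let dPhi_dg y w : U' y -> 'd Phi (F y) ('d g (y, f y) w) = w.
Proof.
move=> Uy; have [_ OF _] := FOmega Uy.
have dg := (g_C1 (U_p Uy)).1; have dPhi := (Phi_C1 OF).1.
have := diff_comp dg dPhi; rewrite (diff_near_id (h := Phi \o g)).
  by move=> /(congr1 (fun h => h w)) /= <-.
by apply: filterS (open_nbhs_nbhs (conj oU (U_p Uy))) => v /Kg[].
Qed.

Let F_near (P : X -> Prop) : (\forall x \near xbar, P x) ->
  \forall y \near ybar, P (F y).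
Proof.
have cF : F y @[y --> ybar] --> F ybar by exact: F_cont.
by rewrite F_ybar in cF => /cF.
Qed.

Let S := Omega `&` [set x | smooth_at Omega x].

Let derivative_converges_pointwise (T : set X) u :
  set_converges (within S (nbhs xbar)) (tangent_cone Omega) T ->
  exists z, forall e, 0 < e -> \forall y \near ybar, E y -> `|'d f y u - z| <= e.
Proof.
move=> [iT oT].
have dg := (g_C1 (U_p U_ybar)).1; have dPhi := (Phi_C1 Oxbar).1.
have [kg kg0 Hg] := linear_lipschitz (diff_continuous dg).
have [kP kP0 HP] := linear_lipschitz (diff_continuous dPhi).
have [|z _ Hz] := @bounded_cluster R Z Y _ E_proper (fun y => 'd f y u) (L * `|u|).
  by apply/withinP_dist; exists 1 => // y _; exact: diff_f_bounded.
(* The cluster value z gives an outer limit direction w, which is then also an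
   inner limit direction; the derivative of Phi turns tangent vectors close to
   w into points of the graph of 'd f y close to (u, z). *)
pose w := 'd g pbar (u, z).
have Tw : T w.
  rewrite -oT; apply/outer_limitP => A /withinP_dist[dA dA0 HA] e e0.
  pose M := (1 + L) * `|u| + kg + 1.
  have M0 : 0 < M.
    by rewrite ltr_wpDl// addr_ge0 ?(ltW kg0)// mulr_ge0// ltW.
  have eM : 0 < e / M by rewrite divr_gt0.
  have nA : \forall y \near ybar, `|F y - xbar| < dA.
    by apply: (F_near (P := fun x => `|x - xbar| < dA)); apply/near_distP; exists dA.
  have ndg : \forall y \near ybar, forall v,
      `|'d g (y, f y) v - 'd g pbar v| <= e / M * `|v|.
    exact: (p_cont U_ybar ((g_C1 (U_p U_ybar)).2 _ eM)).
  have nE : within E (nbhs ybar) [set y | E y /\ `|F y - xbar| < dA /\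
      forall v, `|'d g (y, f y) v - 'd g pbar v| <= e / M * `|v|].
    by apply: filterS2 nA ndg => y h1 h2 Ey; split.
  have [y [[Uy df] [yA hdg]] yz] := Hz _ nE _ eM.
  have [sF TF] := smooth_F Uy df; have [_ dFE] := F_diff Uy df.
  exists (F y), ('d F y u); split.
  - by apply: HA => //; split => //; have [] := FOmega Uy.
  - by rewrite TF; exists u.
  rewrite dFE /w linear_pair_sub.
  have h1 := hdg (u, 'd f y u).
  have h2 := Hg (0, 'd f y u - z).
  rewrite prod_normE/= normr0 max_r// in h2.
  have h3 : `|(u, 'd f y u)| <= (1 + L) * `|u|.
    by apply: pair_norm; exact: diff_f_bounded.
  rewrite (le_lt_trans (ler_normD _ _))// (le_lt_trans (lerD h1 h2))//.
  apply: (@le_lt_trans _ _ (e / M * ((1 + L) * `|u|) + kg * (e / M))).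
    by rewrite lerD// ler_wpM2l// ltW.
  rewrite [kg * _]mulrC -mulrDr -ltr_pdivlMl// invf_div divfK ?gt_eqF//.
  by rewrite /M ltrDl.
exists z => e e0.
(* The factor [kP + 1 + |w|] bounds the error after applying the derivative of [Phi]; [1 + L] pays
   for the change of argument from [u'] to [u]. *)
pose M := (1 + L) * (kP + 1 + `|w|).
have M0 : 0 < M by rewrite mulr_gt0// ltr_wpDr// addr_gt0.
have eM : 0 < e / M by rewrite divr_gt0.
pose eta := Num.min 1 (e / M).
have eta0 : 0 < eta by rewrite lt_min ltr01.
have FS : Filter (within S (nbhs xbar)) by exact: within_filter.
have nT : \forall y \near ybar, S (F y) ->
    exists2 w', tangent_cone Omega (F y) w' & `|w' - w| < e / M.
  move: Tw; rewrite -iT => /inner_limitP/(_ _ eM) nT.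
  exact: (F_near (P := fun x => S x ->
    exists2 w', tangent_cone Omega x w' & `|w' - w| < e / M)).
have ndP : \forall y \near ybar, forall v,
    `|'d Phi (F y) v - 'd Phi xbar v| <= eta * `|v|.
  apply: (F_near (P := fun x => forall v, `|'d Phi x v - 'd Phi xbar v| <= eta * `|v|)).
  exact: (Phi_C1 Oxbar).2.
apply: filterS2 nT ndP => y hT hP [Uy df].
have [sF TF] := smooth_F Uy df; have [_ dFE] := F_diff Uy df.
have [|w' + w'w] := hT; first by split => //; have [] := FOmega Uy.
rewrite TF => -[u' _]; rewrite dFE => w'E.
have Ew' : 'd Phi (F y) w' = (u', 'd f y u') by rewrite -w'E dPhi_dg.
have Ew : 'd Phi xbar w = (u, z) by rewrite -[in LHS]F_ybar dPhi_dg.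
have dist : `|(u', 'd f y u') - (u, z)| <= (kP + 1 + `|w|) * (e / M).
  rewrite -Ew' -Ew (_ : _ - _ = ('d Phi (F y) (w' - w) - 'd Phi xbar (w' - w)) +
    'd Phi xbar (w' - w) + ('d Phi (F y) w - 'd Phi xbar w)); last first.
    have -> : 'd Phi (F y) (w' - w) = 'd Phi (F y) w' - 'd Phi (F y) w.
      exact: linearB.
    by rewrite subrK subrKA.
  have w'w0 := ltW w'w.
  have h1 : `|'d Phi (F y) (w' - w) - 'd Phi xbar (w' - w)| <= e / M.
    rewrite (le_trans (hP _))// (le_trans _ w'w0)// ler_piMl//.
    by rewrite ge_min lexx.
  have h2 : `|'d Phi xbar (w' - w)| <= kP * (e / M).
    by rewrite (le_trans (HP _))// ler_wpM2l// ltW.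
  have h3 : `|'d Phi (F y) w - 'd Phi xbar w| <= `|w| * (e / M).
    by rewrite (le_trans (hP _))// mulrC ler_wpM2l// ge_min lexx orbT.
  rewrite (le_trans (ler_normD _ _))// !mulrDl mul1r lerD//.
  by rewrite (le_trans (ler_normD _ _))// addrC lerD.
move: dist; rewrite prod_normE ge_max => /andP[/= d1 d2].
(* The tangent vector found near [w] lies over [u'] rather than [u]; the uniform bound [L] on the
   derivatives controls the correction. *)
have -> : 'd f y u - z = ('d f y u' - z) - 'd f y (u' - u).
  have -> : 'd f y (u' - u) = 'd f y u' - 'd f y u by exact: linearB.
  by rewrite opprB [RHS]addrC subrKA.
rewrite (le_trans (ler_normB _ _))//.
have h4 := diff_f_bounded (u' - u) (conj Uy df).
rewrite (le_trans (lerD d2 (le_trans h4 (ler_wpM2l L0 d1))))//.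
rewrite (_ : _ + _ = M * (e / M)); last by rewrite /M; ring.
by rewrite mulrC divfK// gt_eqF.
Qed.

(** The limits are linear in [u] because differentiability points accumulate at [ybar]; convergence
    on a basis then gives convergence in operator norm. *)
Let derivative_converges (T : set X) :
  set_converges (within S (nbhs xbar)) (tangent_cone Omega) T ->
  exists2 A : Y -> Z, linear A &
    forall e, 0 < e -> \forall y \near ybar, differentiable f y ->
      forall u, `|'d f y u - A u| <= e * `|u|.
Proof.
move=> HT; have /choice[A HA] := fun u => derivative_converges_pointwise u HT.
have FE := E_proper.
have lA : linear A.
  move=> c u v; apply/eqP; rewrite -subr_eq0 -normr_le0; apply/ler_addgt0Pr => e e0.
  rewrite add0r.
  have M0 : 0 < 1 + `|c| + 1 by rewrite addr_gt0// ltr_pwDl.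
  have eM : 0 < e / (1 + `|c| + 1) by rewrite divr_gt0.
  have nE : within E (nbhs ybar) [set y | [/\
      `|'d f y (c *: u + v) - A (c *: u + v)| <= e / (1 + `|c| + 1),
      `|'d f y u - A u| <= e / (1 + `|c| + 1) &
      `|'d f y v - A v| <= e / (1 + `|c| + 1)]].
    by apply: filterS3 (HA (c *: u + v) _ eM) (HA u _ eM) (HA v _ eM) => y h1 h2 h3 Ey;
      split; [exact: h1|exact: h2|exact: h3].
  have [y [h1 h2 h3]] := filter_ex nE.
  rewrite (_ : _ - _ = c *: ('d f y u - A u) + ('d f y v - A v) -
    ('d f y (c *: u + v) - A (c *: u + v))); last first.
    have -> : 'd f y (c *: u + v) = c *: 'd f y u + 'd f y v by exact: linearP.
    by rewrite scalerBr addrACA -opprD opprB [RHS]addrC subrKA.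
  rewrite (le_trans (ler_normB _ _))// (le_trans (lerD (ler_normD _ _) h1))//.
  rewrite normrZ (le_trans (lerD (lerD (ler_wpM2l (normr_ge0 c) h2) h3) (lexx _)))//.
  set q := e / _; rewrite (_ : `|c| * q + q + q = (1 + `|c| + 1) * q); last by ring.
  by rewrite /q mulrC divfK// gt_eqF.
exists A => // e e0.
have [kc kc0 Hc] := @vcoord_bounded R Y.
pose n := \dim {:Y}.
have M0 : 0 < kc * n%:R + 1 by rewrite ltr_wpDl// mulr_ge0// ltW.
have eM : 0 < e / (kc * n%:R + 1) by rewrite divr_gt0.
have /choice[d Hd] (i : 'I_n) : exists d, 0 < d /\ forall y, `|y - ybar| < d -> E y ->
    `|'d f y (basis_vec i) - A (basis_vec i)| <= e / (kc * n%:R + 1).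
  by have /near_distP[d d0 H] := HA (basis_vec i) _ eM; exists d.
have [d0 d00 d0P] := finite_lower_bound (fun i => (Hd i).1).
have [dU dU0 HU] := (near_distP ybar _).1 (open_nbhs_nbhs (conj oU' U_ybar)).
apply/near_distP; exists (Num.min d0 dU); first by rewrite lt_min d00.
move=> y; rewrite lt_min => /andP[yd yU] df u.
have Ey : E y by split => //; exact: HU.
have dlE : 'd f y u - A u = \sum_(i < n) vcoord i u *:
    ('d f y (basis_vec i) - A (basis_vec i)).
  have -> : A u = \sum_(i < n) vcoord i u *: A (basis_vec i).
    rewrite [in LHS](vcoord_sum u) -[A _]/(pack_linear lA _) linear_sum.
    by apply: eq_bigr => i _; rewrite linearZ.
  have -> : 'd f y u = \sum_(i < n) vcoord i u *: 'd f y (basis_vec i).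
    rewrite [in LHS](vcoord_sum u) linear_sum.
    by apply: eq_bigr => i _; exact: linearZ.
  by rewrite -sumrB; apply: eq_bigr => i _; rewrite scalerBr.
rewrite dlE (le_trans (ler_norm_sum _ _ _))//.
apply: (@le_trans _ _ (\sum_(i < n) kc * `|u| * (e / (kc * n%:R + 1)))).
  apply: ler_sum => i _; rewrite normrZ ler_pM//.
  by apply: (Hd i).2 => //; exact: lt_le_trans (d0P i).
rewrite sumr_const card_ord -(mulr_natr (kc * _ * _)).
rewrite (_ : kc * `|u| * (e / (kc * n%:R + 1)) * n%:R =
  (kc * n%:R) * e * `|u| / (kc * n%:R + 1)); last by ring.
rewrite ler_pdivrMr// -mulrA [leRHS]mulrC ler_wpM2r ?mulr_ge0 ?(ltW e0)//.
by rewrite lerDl.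
Qed.

Lemma smooth_converges_strictly_smooth (T : set X) :
  set_converges (within S (nbhs xbar)) (tangent_cone Omega) T ->
  strictly_smooth_at Omega xbar.
Proof.
move=> /derivative_converges[A lA HA].
apply: (strict_graph_strictly_smooth lA).
exact: (lipschitz_strict oU' U_ybar L0 fL lA HA).
Qed.

End Manifold.

(** [T] is arbitrary, so that (e) alone leads back to (a); properness of the filter is what
    restricting the base points to smooth ones requires. *)
Lemma lipschitzian_manifold_smooth (R : realType) (X : finHilbertType R)
    (Omega : set X) (xbar : X) : Omega xbar -> lipschitzian_manifold Omega xbar ->
  ProperFilter (within (Omega `&` [set x | smooth_at Omega x]) (nbhs xbar)) /\
  forall T, set_converges
      (within (Omega `&` [set x | smooth_at Omega x]) (nbhs xbar))
      (tangent_cone Omega) T ->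
    strictly_smooth_at Omega xbar.
Proof.
move=> Ox [Q [oO OO [Y [Z [J [_ [U' [U'' [Phi [f]]]]]]]]]].
move=> [oU [bij PhiC [g [gK gC]]] fU fL graph].
have [_ _ surj] := bij.
have gK' x : Q x -> g (Phi x) = x by move=> OOx; apply: gK; rewrite inE.
have Kg u : (U' `*` U'') u -> Q (g u) /\ Phi (g u) = u.
  by move=> /surj[x OOx <-]; rewrite gK'.
have fU' y : U' y -> U'' (f y) by move=> Uy; apply: fU; exists y.
have [L L0 fL'] : exists2 L, 0 <= L & forall y y', U' y -> U' y' ->
    `|f y - f y'| <= L * `|y - y'|.
  (* Every real above [M] is a Lipschitz constant; this choice is also nonnegative. *)
  have [M [_ HM]] := fL; exists (Num.max 0 M + 1) => [|y y' Uy Uy'].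
    by rewrite addr_ge0// le_max lexx.
  have := HM (Num.max 0 M + 1); rewrite ltr_pwDr// => [/(_ isT)|]; last first.
    by rewrite le_max lexx orbT.
  by move=> /(_ (y, y')); exact.
split.
  apply: within_proper => d d0.
  exact: (smooth_dense oO OO Ox oU gK' PhiC gC fU' L0 fL' graph d0).
move=> T.
exact: (smooth_converges_strictly_smooth oO OO Ox oU gK' Kg PhiC gC fU' L0 fL' graph).
Qed.

Theorem theorem2p3 (R : realType) (X : finHilbertType R)
    (Omega : set X) (xbar : X)
    (Omega_xbar : Omega xbar) (Omega_closed : locally_closed_at Omega xbar) :
  let a := strictly_smooth_at Omega xbar in
  let b := set_converges (within Omega (nbhs xbar))
             (tangent_cone Omega) (tangent_cone Omega xbar) in
  let c := set_converges
             (within (Omega `&` [set x | derivable_at Omega x]) (nbhs xbar))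
             (tangent_cone Omega) (tangent_cone Omega xbar) in
  let d := set_converges
             (within (Omega `&` [set x | smooth_at Omega x]) (nbhs xbar))
             (tangent_cone Omega) (tangent_cone Omega xbar) in
  let e := exists L : set X, set_converges
             (within (Omega `&` [set x | smooth_at Omega x]) (nbhs xbar))
             (tangent_cone Omega) L in
  (a -> b) /\
  (lipschitzian_manifold Omega xbar ->
    (b -> a) /\ [/\ a <-> b, a <-> c, a <-> d & a <-> e]).
Proof.
move=> a b c d e.
have ab : a -> b by exact: strictly_smooth_converges.
split=> // /(lipschitzian_manifold_smooth Omega_xbar)[pd ea].
have sub (D D' : set X) : D' `<=` D ->
    within D (nbhs xbar) `<=` within D' (nbhs xbar).
  by move=> DD' A H; apply: (filterS (F := nbhs xbar) _ H) => x Ax /DD'.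
have smooth_derivable : Omega `&` [set x | smooth_at Omega x] `<=`
    Omega `&` [set x | derivable_at Omega x].
  by move=> x [Ox [dx _]].
(* Smooth points accumulate at [xbar], so the larger set of derivable points does as well. *)
have pc : ProperFilter (within (Omega `&` [set x | derivable_at Omega x]) (nbhs xbar)).
  split; last exact: within_filter.
  by move=> /(sub _ _ smooth_derivable); case: pd.
have FO (D : set X) : Filter (within D (nbhs xbar)) by exact: within_filter.
(* The implications form a cycle a, b, c, d, e, a: the filters get finer from b to d. *)
have bc : b -> c := set_converges_sub (FO _) pc (sub _ _ (@subIsetl _ _ _)).
have cd : c -> d := set_converges_sub (FO _) pd (sub _ _ smooth_derivable).
have de : d -> e by exists (tangent_cone Omega xbar).
have ea' : e -> a by case=> T; exact: ea.
by split; [auto|split; split; auto].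
Qed.
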